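(* Let $X$ be a tropical cycle in $\mathbb{R}^n$. Then $X$ can be decomposed into a sum of translated fan cycles, i.e. there are fan cycles $F_1,\dots,F_l$ in $\mathbb{R}^n$ and points $\vec p_1,\dots,\vec p_l\in\mathbb{R}^n$ such that $$X=\sum_{i=1}^l (F_i+\vec p_i),$$ where $F_i+\vec p_i$ denotes the translation of $F_i$ by the vector $\vec p_i$.
   Context: $\mathbb{R}^n$ carries the lattice $\mathbb{Z}^n$. For a polyhedron $\tau$, $V_\tau$ is the linear space spanned by differences of points of $\tau$. A tropical polyhedral complex $\mathcal X$ in $\mathbb{R}^n$ is a finite, pure-dimensional polyhedral complex of (closed convex) polyhedra with rational slopes, with an integer weight $\omega(\sigma)$ on every top-dimensional cell (facet), such that for each codimension one cell (ridge) $\tau$ the balancing condition $\sum_{\sigma \text{ facet},\,\tau<\sigma}\omega(\sigma)v_{\sigma/\tau}=0$ holds in $\mathbb{R}^n/V_\tau$, where $v_{\sigma/\tau}$ is the primitive integer generator of the ray obtained by projecting $\sigma$ to $\mathbb{R}^n/V_\tau$. The support $|\mathcal X|$ is the union of the facets of non-zero weight. Two such complexes are equivalent if (after discarding weight-zero facets) they admit a common refinement with the same induced weights. A tropical cycle is an equivalence class of tropical polyhedral complexes. Cycles of the same dimension are added by taking unions (of refined structures) and adding weights; the zero cycle has empty support. A fan cycle is a tropical cycle supported on a finite union of cones with vertex $0$. *)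

(* Defs.v *)
From HB Require Import structures.
From mathcomp Require Import all_boot all_order all_algebra.
From mathcomp Require Import boolp classical_sets functions cardinality fsbigop.
From mathcomp Require Import reals.

Set Implicit Arguments.
Unset Strict Implicit.
Unset Printing Implicit Defensive.

Import Order.TTheory GRing.Theory Num.Theory.
Local Open Scope classical_set_scope.
Local Open Scope ring_scope.

Section Polyhedra.
Context {R : realType} {n : nat}.
Local Notation V := 'cV[R]_n.
Implicit Types (P F : set V).

(* Rational slopes: the facet normals are integral, the right-hand sides are
   arbitrary reals. *)
Definition polyhedron P : Prop :=
  exists m (A : 'M[R]_(m, n)) (b : 'cV[R]_m),
    A \is a mxOver Num.int /\ P = [set x | forall i, (A *m x) i 0 <= b i 0].

Definition cone P : Prop :=
  exists m (A : 'M[R]_(m, n)),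
    A \is a mxOver Num.int /\ P = [set x | forall i, (A *m x) i 0 <= 0].

(* Nonempty faces; the form a = 0 gives P itself. *)
Definition face F P : Prop :=
  F !=set0 /\
  exists a : 'rV[R]_n,
    F = [set x | P x /\ forall y, P y -> (a *m y) 0 0 <= (a *m x) 0 0].

Definition contains_differences P (U : {vspace V}) : Prop :=
  forall x y, P x -> P y -> x - y \in U.

(* V_P: the smallest linear subspace containing all differences of points of
   P; it exists by linspaceP below. *)
Definition linspace P : {vspace V} :=
  xget fullv [set U | contains_differences P U /\
                      forall W, contains_differences P W -> (U <= W)%VS].

Definition pdim P : nat := \dim (linspace P).

Lemma linspaceP P : contains_differences P (linspace P) /\
  forall W, contains_differences P W -> (linspace P <= W)%VS.
Proof.
rewrite /linspace; case: xgetP => [U -> //|noU]; exfalso.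
have ex : exists k, `[< exists U, contains_differences P U /\ \dim U = k >].
  exists (\dim (fullv : {vspace V})); apply/asboolP; exists fullv.
  by split=> // x y _ _; rewrite memvf.
case: (ex_minnP ex) => k /asboolP[U [PU dimU]] kmin.
apply: (noU U); split=> // W PW.
suff /eqP <- : (U :&: W == U)%VS by exact: capvSr.
rewrite eqEdim capvSl /= dimU; apply: kmin; apply/asboolP.
by exists (U :&: W)%VS; split=> // x y Px Py; rewrite memv_cap PU ?PW.
Qed.

(* A vector of Z^n representing, modulo V_t, the primitive generator of the ray
   spanned by the image of s in R^n / V_t; the lattice of the quotient is the
   image of Z^n. *)
Definition is_primitive_generator (s t : set V) (v : V) : Prop :=
  [/\ v \is a mxOver Num.int,
      v \notin linspace t,
      exists (c : R) (x y : V),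
        [/\ 0 <= c, s x, t y & v - c *: (x - y) \in linspace t]
    & forall (k : nat) (w : V), w \is a mxOver Num.int ->
        v - k%:R *: w \in linspace t -> k = 1%N].

(* Any two representatives differ by an element of V_t. *)
Definition primitive_generator (s t : set V) : V :=
  xget 0 [set v | is_primitive_generator s t v].

Definition is_polyhedral_complex (C : set (set V)) : Prop :=
  [/\ finite_set C,
      forall s, C s -> polyhedron s /\ s !=set0,
      forall s t, C s -> face t s -> C t
    & forall s t, C s -> C t -> s `&` t !=set0 ->
        face (s `&` t) s /\ face (s `&` t) t].

End Polyhedra.

(* Only the weights of the top-dimensional cells are meaningful. *)
Record wcomplex (R : realType) (n : nat) := WComplex {
  cells : set (set 'cV[R]_n);
  weight : set 'cV[R]_n -> int }.

(* The dimension d is a parameter, since the empty complex does not determine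
   it. *)
Section TropicalCycles.
Context {R : realType} {n : nat}.
Local Notation V := 'cV[R]_n.
Implicit Types (d : nat) (X Y Z : wcomplex R n) (A B : set (wcomplex R n)).

Definition facet d X (s : set V) : Prop := cells X s /\ pdim s = d.

Definition is_weighted_complex d X : Prop :=
  is_polyhedral_complex (cells X) /\
  forall s, cells X s -> exists2 t, facet d X t & s `<=` t.

Definition balanced_at d X (t : set V) : Prop :=
  \sum_(s \in [set s | facet d X s /\ face t s])
     (weight X s)%:~R *: primitive_generator s t \in linspace t.

Definition is_tropical_complex d X : Prop :=
  is_weighted_complex d X /\
  forall t, cells X t -> (pdim t).+1 = d -> balanced_at d X t.

Definition support d X : set V :=
  \bigcup_(s in [set s | facet d X s /\ weight X s != 0]) s.

Definition discard_zero d X : wcomplex R n :=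
  WComplex [set t | exists s, [/\ facet d X s, weight X s != 0 & face t s]]
           (weight X).

Definition refines d Z X : Prop :=
  [/\ \bigcup_(s in cells Z) s = \bigcup_(s in cells X) s,
      forall s, cells Z s -> exists2 t, cells X t & s `<=` t
    & forall s t, facet d Z s -> facet d X t -> s `<=` t ->
        weight Z s = weight X t].

Definition equivalent d X Y : Prop :=
  exists Z, [/\ is_weighted_complex d Z, refines d Z (discard_zero d X)
              & refines d Z (discard_zero d Y)].

Definition cycle_class d X : set (wcomplex R n) :=
  [set Y | is_tropical_complex d Y /\ equivalent d X Y].

Definition is_tropical_cycle d A : Prop :=
  exists2 X, is_tropical_complex d X & A = cycle_class d X.

Definition cycle_zero d : set (wcomplex R n) :=
  cycle_class d (WComplex set0 (fun=> 0)).

Definition union_complex X Y : wcomplex R n :=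
  WComplex (cells X `|` cells Y)
    (fun s => (if `[< cells X s >] then weight X s else 0) +
              (if `[< cells Y s >] then weight Y s else 0)).

(* The sum of two cycles is computed on representatives refined so that their
   union is again a polyhedral complex. *)
Definition cycle_add d A B : set (wcomplex R n) :=
  [set Z | exists X Y, [/\ A X, B Y,
                           is_polyhedral_complex (cells X `|` cells Y)
                         & cycle_class d (union_complex X Y) Z]].

Definition cycle_support d A : set V := \bigcup_(X in A) support d X.

Definition is_fan_cycle d A : Prop :=
  is_tropical_cycle d A /\
  exists K : set (set V),
    [/\ finite_set K, forall c, K c -> cone c
      & cycle_support d A = \bigcup_(c in K) c].

Definition translate (p : V) (s : set V) : set V := [set x + p | x in s].

Definition translate_complex (p : V) X : wcomplex R n :=
  WComplex [set translate p s | s in cells X]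
           (fun s => weight X (translate (- p) s)).

Definition translate_cycle (p : V) A : set (wcomplex R n) :=
  [set translate_complex p X | X in A].

End TropicalCycles.

(* Main.v *)
Require Import Defs.
From mathcomp Require Import all_boot all_order all_algebra.
From mathcomp Require Import boolp classical_sets functions cardinality fsbigop.
From mathcomp Require Import reals ring lra.

(* The cells of X are unions of cells of a finite rational hyperplane arrangement
   A, so X is a weight function w on R^n that is constant on the cells of A.  For a
   point q let S_q w be the function x |-> w (q + e (x - q)), e > 0 small: the
   star of X at q, a fan cycle with vertex q, balanced because its germ at x is
   the germ of w at q + e (x - q).  On sign vectors, q and x are combined by the
   product of the face semigroup of A, so the points of R^n act on functions
   constant on cells through this semigroup, and its algebra has a left identity:
   there are integers c_i and points q_i with w = sum_i c_i S_(q_i) w for all such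
   w.  This follows by adding one hyperplane H at a time: if E is an identity for
   the old arrangement, then 1 - E maps into the span of the differences y - y0,
   where y0 lies on H in the closure of the cell of y and in the same old cell,
   and these are killed by 1 - E' for an identity E' of the arrangement that is
   induced on H. *)

Set Implicit Arguments.
Unset Strict Implicit.
Unset Printing Implicit Defensive.

Import Order.TTheory GRing.Theory Num.Theory.

(** * Closed cells of an arrangement *)

Section Arrangement.
Local Open Scope classical_set_scope.
Local Open Scope ring_scope.
Context {R : realType} {n : nat}.
Local Notation V := 'cV[R]_n.
Implicit Types (a : 'rV[R]_n) (h : 'rV[R]_n * R) (A H K : seq ('rV[R]_n * R)).
Implicit Types (x y z p q u v : V) (P Q : set V) (w : V -> int).

(** The obstacle is that cycles are classes modulo common refinement, while sums and stars are easy
    only for functions. So everything is read off the function [weight_at]: at points whose flat has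
    dimension [d] it determines a complex up to equivalence, and all stars live on the one
    arrangement [A], so that adding them is adding functions. Balancing is restated for the germ of
    a function modulo a linear space, since the point at which the germ of a star is read need not
    lie on a ridge. The coefficients c_i have an Euler characteristic flavour. For points a_1 < ...
    < a_k on a line one may take the stars at the a_i with coefficient 1 and the stars at points
    between neighbours with coefficient -1. Negative coefficients do no harm, because weights are
    integers. *)

Definition dot a x : R := (a *m x) 0 0.

Lemma dotD a x y : dot a (x + y) = dot a x + dot a y.
Proof. by rewrite /dot mulmxDr mxE. Qed.

Lemma dotZ a (c : R) x : dot a (c *: x) = c * dot a x.
Proof. by rewrite /dot -scalemxAr mxE. Qed.

Lemma dotN a x : dot a (- x) = - dot a x.
Proof. by rewrite -scaleN1r dotZ mulN1r. Qed.

Lemma dotB a x y : dot a (x - y) = dot a x - dot a y.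
Proof. by rewrite dotD dotN. Qed.

Definition sgn h x : R := Num.sg (dot h.1 x - h.2).

Definition same_cell A x y := forall h, h \in A -> sgn h x = sgn h y.

(** The closure of the cell of [z], described by signs alone: each sign of [z] is kept or
    degenerates to 0. The faces of this set are the closed cells of its own points. *)
Definition closed_cell A z : set V :=
  [set x | forall h, h \in A -> sgn h x = 0 \/ sgn h x = sgn h z].

(** The direction space of the cell of [x]: a small move along such a vector changes no sign. *)
Definition flat A x : {vspace V} :=
  (\bigcap_(h <- A | (sgn h x == 0)%R) lker (linfun (mulmx h.1)))%VS.

Lemma flatP A x v :
  v \in flat A x <-> forall h, h \in A -> sgn h x = 0 -> dot h.1 v = 0.
Proof.
rewrite /flat; elim: A => [|h A IH]; first by rewrite big_nil memvf.
have kerE : (v \in lker (linfun (mulmx h.1))) = (dot h.1 v == 0).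
  rewrite memv_ker lfunE /= /dot; apply/eqP/eqP => [->|e]; first by rewrite mxE.
  by apply/matrixP => i j; rewrite !ord1 e mxE.
rewrite big_cons; case: (eqVneq (sgn h x) 0) => hx0.
  rewrite memv_cap kerE; split=> [/andP[/eqP e /IH vA] g|vA].
    by rewrite inE => /predU1P[->|/vA].
  rewrite vA ?mem_head // eqxx; apply/IH => g gA.
  by apply: vA; rewrite inE gA orbT.
split=> [/IH vA g|vA].
  by rewrite inE => /predU1P[-> e|/vA]; first by rewrite e eqxx in hx0.
by apply/IH => g gA; apply: vA; rewrite inE gA orbT.
Qed.

(** The finitely many hyperplanes that miss [x] are not reached by a short step. The bound [e <= 1]
    keeps a step toward a point of a convex set inside that set; the claim for all smaller [d]
    allows the steps of two arrangements to be compared. *)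
Lemma push_exists A x v : exists e : R, [/\ 0 < e, e <= 1 &
  forall h, h \in A -> forall d, 0 < d <= e ->
   sgn h (x + d *: v) = if sgn h x == 0 then Num.sg (dot h.1 v) else sgn h x].
Proof.
elim: A => [|h A [e [e0 e1 IH]]]; first by exists 1; split.
pose c := dot h.1 v; pose r := dot h.1 x - h.2.
have sgE d : sgn h (x + d *: v) = Num.sg (r + d * c).
  by rewrite /sgn dotD dotZ addrAC.
have sr : sgn h x = Num.sg r by [].
have [r0|r0] := eqVneq r 0.
  exists e; split=> // g; rewrite inE => /predU1P[->|gA] d /andP[d0 de].
    by rewrite sgE sr r0 sgr0 eqxx add0r sgrM (gtr0_sg d0) mul1r.
  by apply: IH; rewrite // d0 de.
have c1 : 0 < `|c| + 1 by rewrite ltr_wpDl.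
have q0 : 0 < `|r| / (`|c| + 1) by rewrite divr_gt0 ?normr_gt0.
(* The summand 1 excludes a zero denominator, and the factor 1/2 makes the bound [|d * c| < |r|]
   strict. *)
exists (Num.min e (`|r| / (`|c| + 1) / 2)); split.
- by rewrite lt_min e0 divr_gt0.
- by rewrite ge_min e1.
move=> g gA d; rewrite le_min => /andP[d0 /andP[de dq]].
move: gA; rewrite inE => /predU1P[->|gA].
  rewrite sgE sr sgr_eq0 (negPf r0).
  have dc : `|d * c| < `|r|.
    rewrite normrM (gtr0_norm d0).
    apply: (@le_lt_trans _ _ (d * (`|c| + 1))).
      by rewrite ler_wpM2l ?(ltW d0) // lerDl ler01.
    by rewrite -ltr_pdivlMr //; apply: le_lt_trans dq _;
      rewrite ltr_pdivrMr // ltr_pMr // ltr1n.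
  move: dc; rewrite ltr_norml => /andP[lo hi].
  case: (ltrP r 0) r0 lo hi => [rl _ lo hi|rg r0 lo hi].
    rewrite (ltr0_sg rl) ltr0_sg //; rewrite (ltr0_norm rl) in hi; lra.
  rewrite (ger0_norm rg) in lo.
  have rp : 0 < r by rewrite lt_def r0.
  rewrite (gtr0_sg rp) gtr0_sg //; lra.
by apply: IH => //; rewrite d0 de.
Qed.

Definition push_size A x v : R := sval (cid (push_exists A x v)).

Definition push A x v : V := x + push_size A x v *: v.

(* The product of the face semigroup of [A] (Tits product) on sign vectors. *)
Definition tits A q x : V := push A q (x - q).

Lemma push_size_gt0 A x v : 0 < push_size A x v.
Proof. by rewrite /push_size; case: cid => e []. Qed.

Lemma push_size_le1 A x v : push_size A x v <= 1.
Proof. by rewrite /push_size; case: cid => e []. Qed.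

Lemma sgn_push A x v h : h \in A ->
  sgn h (push A x v) = if sgn h x == 0 then Num.sg (dot h.1 v) else sgn h x.
Proof.
rewrite /push /push_size; case: cid => e [e0 _ He] /= hA.
by apply: He => //; rewrite e0 lexx.
Qed.

Lemma sgn_tits A q x h : h \in A ->
  sgn h (tits A q x) = if sgn h q == 0 then sgn h x else sgn h q.
Proof.
move=> hA; rewrite sgn_push //; case: eqP => // /eqP; rewrite sgr_eq0 subr_eq0.
by move=> /eqP e; rewrite dotB e.
Qed.

Lemma same_cell_sym A x y : same_cell A x y -> same_cell A y x.
Proof. by move=> xy h hA; rewrite xy. Qed.

Lemma flat_push A x v : v \in flat A (push A x v).
Proof.
apply/flatP => h hA; rewrite sgn_push //.
by case: eqP => // _ /eqP; rewrite sgr_eq0 => /eqP.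
Qed.

Lemma sub_flat A x y :
  (forall h, h \in A -> sgn h y = 0 -> sgn h x = 0) ->
  (flat A x <= flat A y)%VS.
Proof.
by move=> xy; apply/subvP => v /flatP vx; apply/flatP => h hA /(xy _ hA); exact: vx.
Qed.

Lemma same_cell_flat A x y : same_cell A x y -> flat A x = flat A y.
Proof.
move=> xy; apply/eqP; rewrite eqEsubv; apply/andP.
by split; apply: sub_flat => h hA; rewrite xy.
Qed.

Lemma flat_sub_push A x v : (flat A x <= flat A (push A x v))%VS.
Proof. by apply: sub_flat => h hA; rewrite sgn_push //; case: eqP => // ->. Qed.

Lemma flat_sub_tits A q x : (flat A x <= flat A (tits A q x))%VS.
Proof.
by apply: sub_flat => h hA; rewrite sgn_tits //; case: eqP => // q0 e; case: q0.
Qed.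

Lemma closed_cell_refl A z : closed_cell A z z.
Proof. by move=> h hA; right. Qed.

Lemma closed_cell_sub A x y :
  closed_cell A y x -> closed_cell A x `<=` closed_cell A y.
Proof.
move=> yx u xu h hA; case: (xu h hA) => [->|->]; first by left.
exact: yx.
Qed.

Lemma closed_cell_same A x y : same_cell A x y -> closed_cell A x = closed_cell A y.
Proof.
move=> xy; apply/seteqP; split; apply: closed_cell_sub => h hA; right; rewrite xy //.
Qed.

Lemma closed_cell_inj A x y :
  closed_cell A x = closed_cell A y -> same_cell A x y.
Proof.
move=> e h hA.
have: closed_cell A y x by rewrite -e; exact: closed_cell_refl.
have: closed_cell A x y by rewrite e; exact: closed_cell_refl.
by move=> /(_ h hA)[e1|->] // /(_ h hA)[->|->].
Qed.

Lemma closed_cell_push A x v : closed_cell A (push A x v) x.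
Proof.
move=> h hA; rewrite sgn_push //; case: eqP => [->|_]; by [left|right].
Qed.

Lemma closed_cell_flat A z x y :
  closed_cell A z x -> closed_cell A z y -> x - y \in flat A z.
Proof.
have main u h : sgn h z = 0 -> sgn h u = 0 \/ sgn h u = sgn h z -> dot h.1 u = h.2.
  move=> -> uz; apply/eqP; rewrite -subr_eq0 -sgr_eq0 -/(sgn h u); apply/eqP.
  by case: uz.
move=> zx zy; apply/flatP => h hA hz.
by rewrite dotB (main x) ?(main y) ?subrr //; [exact: zy|exact: zx].
Qed.

(** * Convex sets and relative interior points *)

Definition convex P := forall x y (t : R), P x -> P y -> 0 <= t -> t <= 1 ->
  P (x + t *: (y - x)).

Lemma sgn_between h x y (t : R) (e : R) : 0 <= t -> t <= 1 ->
  sgn h x = 0 \/ sgn h x = e -> sgn h y = 0 \/ sgn h y = e ->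
  sgn h (x + t *: (y - x)) = 0 \/ sgn h (x + t *: (y - x)) = e.
Proof.
move=> t0 t1; rewrite /sgn dotD dotZ dotB.
set a := dot h.1 x; set b := dot h.1 y; set c := h.2.
have -> : a + t * (b - a) - c = (1 - t) * (a - c) + t * (b - c) by lra.
move: (a - c) (b - c) => {a b c} a b.
have s0 : 0 <= 1 - t by rewrite subr_ge0.
have [->|tn0] := eqVneq t 0; first by rewrite subr0 mul1r mul0r addr0.
have tp : 0 < t by rewrite lt_def tn0.
have [->|sn0] := eqVneq (1 - t) 0.
  by rewrite mul0r add0r sgrM (gtr0_sg tp) mul1r.
have sp : 0 < 1 - t by rewrite lt_def sn0.
have sl r : Num.sg (t * r) = Num.sg r by rewrite sgrM (gtr0_sg tp) mul1r.
have sm r : Num.sg ((1 - t) * r) = Num.sg r by rewrite sgrM (gtr0_sg sp) mul1r.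
have n11 : 1 = -1 :> R -> False.
  by move=> /eqP; rewrite -subr_eq0 opprK -mulr2n pnatr_eq0.
have n10 : 1 = 0 :> R -> False by move=> /eqP; rewrite oner_eq0.
have n20 : -1 = 0 :> R -> False by move=> /eqP; rewrite oppr_eq0 oner_eq0.
case: (ltrgtP a 0) => a0; case: (ltrgtP b 0) => b0;
  rewrite ?a0 ?b0 ?mulr0 ?addr0 ?add0r ?sl ?sm ?sgr0 ?(gtr0_sg a0) ?(ltr0_sg a0)
    ?(gtr0_sg b0) ?(ltr0_sg b0) //.
- move=> [/n20//|<-] _; right; rewrite ltr0_sg //.
  by rewrite -oppr_gt0 opprD -!mulrN addr_gt0 // mulr_gt0 // oppr_gt0.
- by move=> [/n20//|<-] [/n10|/n11].
- by move=> [/n10//|<-] [/n20|/esym/n11].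
- by move=> [/n10//|<-] _; right; rewrite gtr0_sg // addr_gt0 // mulr_gt0.
Qed.

Lemma convex_closed_cell A z : convex (closed_cell A z).
Proof.
by move=> x y t zx zy t0 t1 h hA; apply: sgn_between => //; [exact: zx|exact: zy].
Qed.

Lemma convex_tits P A x y : convex P -> P x -> P y -> P (tits A x y).
Proof.
by move=> cP Px Py; apply: cP; rewrite // ?push_size_le1 // ltW ?push_size_gt0.
Qed.

Lemma sub_tits_flat A x y :
  x - y \in flat A (tits A x y).
Proof.
by rewrite -opprB memvN; exact: flat_push.
Qed.

(** Dimensions are bounded, so a flat of maximal dimension occurs. Such a point replaces a
    topological notion of relative interior. *)
Lemma exists_max_flat P A : P !=set0 -> exists2 y, P y &
  forall z, P z -> (flat A y <= flat A z)%VS -> flat A y = flat A z.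
Proof.
move=> [x0 Px0].
have ex : exists k, `[< exists2 x, P x & \dim (flat A x) = k >].
  by exists (\dim (flat A x0)); apply/asboolP; exists x0.
have ub k : `[< exists2 x, P x & \dim (flat A x) = k >] -> (k <= \dim {:V})%N.
  by move=> /asboolP[x _ <-]; apply: dimvS; exact: subvf.
case: (ex_maxnP ex ub) => k /asboolP[y Py yk] ymax.
exists y => // z Pz yz; apply/eqP; rewrite eqEdim yz yk; apply: ymax.
by apply/asboolP; exists z.
Qed.

(* The point of [Q] whose flat has maximal dimension lies in the relative
   interior of [Q]. *)
Lemma convex_sub_closed_cell A z Q : convex Q -> Q !=set0 ->
  Q `<=` closed_cell A z -> exists2 y, Q y & Q `<=` closed_cell A y.
Proof.
move=> cQ Q0 Qz; case: (exists_max_flat A Q0) => y Qy ymax.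
exists y => // u Qu h hA.
(* A step from [y] toward [u] stays in [Q] and can only enlarge the flat. By maximality it does not,
   so [y - u] lies in the flat of [y], and every hyperplane through [y] contains [u]. *)
have Qc : Q (tits A y u) by exact: convex_tits.
have le : (flat A y <= flat A (tits A y u))%VS.
  apply: sub_flat => g gA; rewrite sgn_tits //; by case: eqP => // ->.
have e := ymax _ Qc le.
case: (Qz _ Qu h hA) => [|hu]; first by left.
right; case: (Qz _ Qy h hA) => [hy|->//].
have /flatP/(_ h hA hy) : y - u \in flat A y by rewrite e; exact: sub_tits_flat.
rewrite hy dotB => /eqP; rewrite subr_eq0 => /eqP de.
by rewrite /sgn -de -/(sgn h y) hy.
Qed.

End Arrangement.

(** * A combinatorial resolution of the identity *)

Section EulerIdentity.
Local Open Scope classical_set_scope.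
Local Open Scope ring_scope.
Context {R : realType} {n : nat}.
Local Notation V := 'cV[R]_n.
Implicit Types (h : 'rV[R]_n * R) (A H K : seq ('rV[R]_n * R)).
Implicit Types (x y z p q u v : V) (w : V -> int).

(** The affine subspace cut out by [K]. Carrying it along lets the induction pass to the arrangement
    induced on a hyperplane without changing the ambient space. *)
Definition on_all K x := forall h, h \in K -> sgn h x = 0.

Lemma on_all_cons h K x : on_all (h :: K) x <-> sgn h x = 0 /\ on_all K x.
Proof.
split=> [xK|[hx xK] g].
  by split=> [|g gK]; apply: xK; rewrite inE ?eqxx // gK orbT.
by rewrite inE => /predU1P[->|/xK].
Qed.

Lemma same_cell_cons h H x y :
  sgn h x = sgn h y -> same_cell H x y -> same_cell (h :: H) x y.
Proof. by move=> hxy xy g; rewrite inE => /predU1P[->|/xy]. Qed.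

Lemma on_all_tits A K q x : {subset K <= A} -> on_all K q -> on_all K x ->
  on_all K (tits A q x).
Proof. by move=> KA qK xK h hK; rewrite sgn_tits ?KA // qK // eqxx xK. Qed.

Lemma sgn_crossing h x y : sgn h x != sgn h y ->
  exists t : R, [/\ 0 <= t, t <= 1 & sgn h (x + t *: (y - x)) = 0].
Proof.
pose a := dot h.1 x - h.2; pose b := dot h.1 y - h.2.
have E t : sgn h (x + t *: (y - x)) = Num.sg (a + t * (b - a)).
  by congr Num.sg; rewrite dotD dotZ dotB /a /b; lra.
rewrite -[sgn h x]/(Num.sg a) -[sgn h y]/(Num.sg b) => ab.
suff [t [t0 t1 e]] : exists t : R, [/\ 0 <= t, t <= 1 & a + t * (b - a) = 0].
  by exists t; split; rewrite // E e sgr0.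
have [a0|a0] := eqVneq a 0; first by exists 0; rewrite lexx ler01 a0; split=> //; lra.
have [b0|b0] := eqVneq b 0; first by exists 1; rewrite lexx ler01 b0; split=> //; lra.
have d0 : a - b != 0 by rewrite subr_eq0; apply: contraNneq ab => ->.
exists (a / (a - b)).
suff [t0 t1] : 0 <= a / (a - b) /\ a / (a - b) <= 1 by split=> //; field.
case: (ltrgtP a 0) a0 => // sa _; case: (ltrgtP b 0) b0 => // sb _.
- by rewrite !ltr0_sg // eqxx in ab.
- have D : 0 < b - a by lra.
  have -> : a / (a - b) = (- a) / (b - a) by rewrite -[b - a]opprB invrN mulrNN.
  by split; [rewrite divr_ge0; lra|rewrite ler_pdivrMr //; lra].
- have D : 0 < a - b by lra.
  by split; [rewrite divr_ge0; lra|rewrite ler_pdivrMr //; lra].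
by rewrite !gtr0_sg // eqxx in ab.
Qed.

Lemma sgn_between_same h x y (t : R) : 0 <= t -> t <= 1 ->
  sgn h x = sgn h y -> sgn h (x + t *: (y - x)) = sgn h x.
Proof.
move=> t0 t1 xy.
have [//|xyt] := eqVneq (sgn h (x + t *: (y - x))) (sgn h x).
move: (xyt); rewrite /sgn dotD dotZ dotB; move: xy; rewrite /sgn.
set a := dot h.1 x; set b := dot h.1 y; set c := h.2.
have -> : a + t * (b - a) - c = (1 - t) * (a - c) + t * (b - c) by lra.
move: (a - c) (b - c) => {}a {}b.
case: (ltrgtP a 0) => a0; case: (ltrgtP b 0) => b0;
  rewrite ?a0 ?b0 ?mulr0 ?addr0 ?eqxx ?(ltr0_sg a0) ?(gtr0_sg a0) ?(ltr0_sg b0)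
    ?(gtr0_sg b0) ?sgr0 //; try lra.
  by move=> _; rewrite ltr0_sg ?eqxx //; nra.
by move=> _; rewrite gtr0_sg ?eqxx //; nra.
Qed.

(** On a segment between two points of one cell of [H] no sign of [H] changes, so the point where
    the segment meets [h] is still in that cell. *)
Lemma same_cell_crossing h H K x y : on_all K x -> on_all K y ->
  same_cell H x y -> sgn h x != sgn h y ->
  exists2 z, on_all (h :: K) z & same_cell H z x.
Proof.
move=> xK yK xy /sgn_crossing[t [t0 t1 ht]]; exists (x + t *: (y - x)).
  apply/on_all_cons; split=> // g gK.
  by rewrite sgn_between_same // xK ?yK.
by move=> g gH; apply: sgn_between_same => //; exact: xy.
Qed.

(* With [E'] and [E] the identities for [H] on the flat of [h :: K] and on that
   of [K], the product [1 - (1 - E') (1 - E)] works for [h :: H] on [K]. *)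
Lemma euler_identity A H K : {subset H <= A} -> {subset K <= A} ->
  (exists x, on_all K x) ->
  exists E : seq (int * V), (forall e, e \in E -> on_all K e.2) /\
    forall w, (forall x y, on_all K x -> on_all K y -> same_cell H x y -> w x = w y) ->
      forall x, on_all K x -> w x = \sum_(e <- E) e.1 * w (tits A e.2 x).
Proof.
elim: H K => [|h H IH] K HA KA [x0 x0K].
  exists [:: (1, x0)]; split=> [e|w wc x xK].
    by rewrite inE => /eqP->.
  rewrite big_seq1 mul1r; apply: wc => //.
  exact: on_all_tits.
have hA : h \in A by rewrite HA ?mem_head.
have {}HA : {subset H <= A} by move=> g gH; rewrite HA // inE gH orbT.
have [E [EK Eid]] := IH K HA KA (ex_intro _ x0 x0K).
case: (EM (exists z, on_all (h :: K) z)) => [ex|nex]; last first.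
  (* When [h] misses the flat of [K], it splits no cell of [H] there, and the old coefficients still
     serve. *)
  exists E; split=> // w wc x xK; apply: Eid => // u v uK vK uv.
  apply: wc => //; apply: same_cell_cons => //.
  have [//|/(same_cell_crossing uK vK uv)[z zK _]] := eqVneq (sgn h u) (sgn h v).
  by case: nex; exists z.
have hKA : {subset h :: K <= A}.
  by move=> g; rewrite inE => /predU1P[->|/KA].
have [E' [E'K E'id]] := IH (h :: K) HA hKA ex.
have E'K1 e : e \in E' -> on_all K e.2 by move=> /E'K/on_all_cons[].
(* The cross terms: a star of a star is the star at the product of the two centres, because the Tits
   product is associative on sign vectors. *)
pose E2 := [seq (- (f.1 * e.1), tits A e.2 f.2) | f <- E, e <- E'].
exists (E' ++ E ++ E2); split=> [e|w wc x xK].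
  rewrite !mem_cat => /or3P[/E'K1//|/EK//|/allpairsP[[f g] /= [fE gE ->]] /=].
  by apply: on_all_tits; rewrite //; [exact: E'K1|exact: EK].
(* [g] is what [E'] leaves over of [w]. It vanishes at every point whose cell of [H] meets [h];
   hence it is constant on the cells of [H], although [w] need not be, and [E] reproduces it. *)
pose g y := w y - \sum_(e <- E') e.1 * w (tits A e.2 y).
have g0 y z : on_all K y -> on_all (h :: K) z -> same_cell H z y -> g y = 0.
  move=> yK zhK zy; have [hz zK] := (on_all_cons _ _ _).1 zhK.
  have fc u v : on_all (h :: K) u -> on_all (h :: K) v -> same_cell H u v ->
      w (tits A u y) = w (tits A v y).
    move=> /on_all_cons[hu uK] /on_all_cons[hv vK] uv.
    apply: wc; try exact: on_all_tits.
    apply: same_cell_cons; first by rewrite !sgn_tits // hu hv eqxx.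
    by move=> k kH; rewrite !sgn_tits ?HA // uv.
  have wE : w (tits A z y) = w y.
    apply: wc => //; first exact: on_all_tits.
    apply: same_cell_cons; first by rewrite sgn_tits // hz eqxx.
    by move=> k kH; rewrite sgn_tits ?HA // zy //; case: eqP.
  (* The identity for [E'] holds only on the flat of [h :: K], where [y] need not lie; it is
     therefore applied at [z], to the function sending [u] to [w (tits A u y)]. *)
  rewrite /g -wE (E'id (fun u => w (tits A u y)) fc z zhK); apply/eqP.
  rewrite subr_eq0; apply/eqP; apply: eq_big_seq => e eE; congr (_ * _).
  have [he eK] := (on_all_cons _ _ _).1 (E'K _ eE).
  apply: wc; try by do 2?[exact: on_all_tits|apply: on_all_tits].
  apply: same_cell_cons; first by rewrite !sgn_tits // he hz !eqxx.
  move=> k kH; rewrite !sgn_tits ?HA // zy //.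
  by case: (eqVneq (sgn k e.2) 0) => [_|/negPf->//]; case: (eqVneq (sgn k y) 0).
have gc u v : on_all K u -> on_all K v -> same_cell H u v -> g u = g v.
  move=> uK vK uv; have [huv|huv] := eqVneq (sgn h u) (sgn h v).
    rewrite /g (wc u v) //; last exact: same_cell_cons.
    congr (_ - _); apply: eq_big_seq => e eE; congr (_ * _).
    have eK := E'K1 _ eE.
    apply: wc; try exact: on_all_tits.
    apply: same_cell_cons; first by rewrite !sgn_tits // huv.
    by move=> k kH; rewrite !sgn_tits ?HA // uv.
  have [z zK zu] := same_cell_crossing uK vK uv huv.
  by rewrite (g0 u z) ?(g0 v z) // => k kH; rewrite zu // uv.
have /eqP := Eid g gc x xK; rewrite {1}/g subr_eq => /eqP ->.
rewrite !big_cat /= addrC; congr (_ + _).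
rewrite big_allpairs_dep /= -big_split /=; apply: eq_big_seq => f fE.
rewrite /g mulrBr mulr_sumr -sumrN; congr (_ + _).
apply: eq_big_seq => e eE; rewrite mulNr mulrA; congr (- (_ * _)).
have fK := EK _ fE; have eK := E'K1 _ eE.
apply: wc; try by do 2?[exact: on_all_tits|apply: on_all_tits].
move=> k kH; have kA : k \in A by move: kH; rewrite inE => /predU1P[->|/HA].
rewrite !sgn_tits //; by case: (eqVneq (sgn k e.2) 0) => [_|/negPf->].
Qed.

Lemma euler_decomposition A : exists E : seq (int * V),
  forall w, (forall x y, same_cell A x y -> w x = w y) ->
    forall x, w x = \sum_(e <- E) e.1 * w (tits A e.2 x).
Proof.
have AA : {subset A <= A} by [].
have nA : {subset [::] <= A} by [].
have [|E [_ EP]] := @euler_identity A A [::] AA nA; first by exists 0.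
by exists E => w wc x; apply: EP => // y z _ _; exact: wc.
Qed.

End EulerIdentity.

(** * Polyhedra, faces and linear spans *)

Section Linspace.
Local Open Scope classical_set_scope.
Local Open Scope ring_scope.
Context {R : realType} {n : nat}.
Local Notation V := 'cV[R]_n.
Implicit Types (h : 'rV[R]_n * R) (A H K : seq ('rV[R]_n * R)).
Implicit Types (x y z p q u v : V) (P Q F : set V) (U : {vspace V}).

Definition integral A := forall h, h \in A -> h.1 \is a mxOver Num.int.

Definition saturated A P := forall x y, P x -> closed_cell A x y -> P y.

(** Such a set is a convex union of closed cells. A polyhedron is tame for every arrangement that
    contains its bounding hyperplanes, so one arrangement serves finitely many polyhedra. *)
Definition tame A P := convex P /\ saturated A P.

Lemma tame_closed_cell A z : tame A (closed_cell A z).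
Proof.
split; first exact: convex_closed_cell.
by move=> x y /closed_cell_sub; apply.
Qed.

Lemma same_cell_saturated A P x y :
  saturated A P -> same_cell A x y -> P x -> P y.
Proof. by move=> sP xy /sP; apply=> h hA; right; rewrite xy. Qed.

Lemma halfspaces_tame A K : {subset K <= A} ->
  tame A [set x | forall h, h \in K -> sgn h x <= 0].
Proof.
move=> KA; split=> [x y t xP yP t0 t1 h hK|x y xP xy h hK].
  have := xP h hK; have := yP h hK; rewrite /sgn !sgr_le0 dotD dotZ dotB.
  by set a := dot _ _; set b := dot _ _; move=> a0 b0; nra.
by case: (xy h (KA _ hK)) => [->//|->]; exact: xP.
Qed.

Lemma dot_row m (A : 'M[R]_(m, n)) i x : dot (row i A) x = (A *m x) i 0.
Proof. by rewrite /dot -row_mul mxE. Qed.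

(** The clause on [b = 0] lets the same matrix serve for cones. *)
Lemma halfspaces_matrix K : integral K ->
  exists m (A : 'M[R]_(m, n)) (b : 'cV[R]_m), [/\ A \is a mxOver Num.int,
    (forall h, h \in K -> h.2 = 0) -> b = 0 &
    [set x | forall h, h \in K -> sgn h x <= 0] =
      [set x | forall i, (A *m x) i 0 <= b i 0]].
Proof.
move=> Kint; pose A := \matrix_(i < size K) (nth (0, 0) K i).1.
pose b : 'cV[R]_(size K) := \col_i (nth (0, 0) K i).2; exists (size K), A, b; split.
- apply/mxOverP => i j; rewrite !mxE.
  exact: (mxOverP (Kint _ (mem_nth _ (ltn_ord i)))).
- by move=> K0; apply/matrixP => i j; rewrite !mxE K0 ?mem_nth.
have E x i : (A *m x) i 0 <= b i 0 <-> sgn (nth (0, 0) K i) x <= 0.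
  by rewrite -dot_row rowK mxE sgr_le0 subr_le0.
apply/seteqP; split=> x /= xP.
  by move=> i; apply/E/xP/mem_nth.
move=> h /(nthP (0, 0))[i iK <-].
by have /E := xP (Ordinal iK).
Qed.

Lemma polyhedron_halfspaces P : polyhedron P <->
  exists2 K, integral K & P = [set x | forall h, h \in K -> sgn h x <= 0].
Proof.
split=> [[m [A [b [Aint ->]]]]|[K /halfspaces_matrix[m [A [b [Aint _ ->]]]] ->]];
  last by exists m, A, b.
exists [seq (row i A, b i 0) | i <- enum 'I_m].
  move=> h /mapP[i _ ->] /=; apply/mxOverP => k j; rewrite mxE.
  exact: (mxOverP Aint).
apply/seteqP; split=> x /= xP.
  by move=> h /mapP[i _ ->]; rewrite sgr_le0 dot_row subr_le0; exact: xP.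
move=> i; rewrite -subr_le0 -dot_row -sgr_le0.
by apply: (xP (row i A, b i 0)); apply/mapP; exists i; rewrite ?mem_enum.
Qed.

Lemma polyhedron_tame P : polyhedron P -> exists2 A, integral A &
  forall A', {subset A <= A'} -> tame A' P.
Proof.
move=> /polyhedron_halfspaces[K Kint ->]; exists K => // A'.
exact: halfspaces_tame.
Qed.

Definition opp_half h : 'rV[R]_n * R := (- h.1, - h.2).

Lemma sgn_opp_half h x : sgn (opp_half h) x = - sgn h x.
Proof. by rewrite /sgn /= /dot mulNmx mxE -opprD sgrN. Qed.

Lemma sgn_cell h x (e : R) : e = 0 \/ e = 1 \/ e = -1 ->
  sgn h x = 0 \/ sgn h x = e <->
  (e != 1 -> sgn h x <= 0) /\ (e != -1 -> 0 <= sgn h x).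
Proof.
have n11 : (1 == -1 :> R) = false.
  by apply/negbTE; rewrite -subr_eq0 opprK -mulr2n pnatr_eq0.
have n11' : (-1 == 1 :> R) = false by rewrite eq_sym n11.
have n01 : (0 == -1 :> R) = false by rewrite eq_sym oppr_eq0 oner_eq0.
have n10 : (0 == 1 :> R) = false by rewrite eq_sym oner_eq0.
have l01 : (1 <= 0 :> R) = false by rewrite lt_geF ?ltr01.
have lN10 : (0 <= -1 :> R) = false by rewrite oppr_ge0.
have eqb (a b : R) : (a = b) = (a == b) :> Prop by apply/propext; split=> /eqP.
case=> [->|[->|->]]; rewrite /sgn; case: sgrP => _; rewrite !eqb;
  rewrite ?eqxx ?n11 ?n11' ?n01 ?n10 ?oppr_eq0 ?oner_eq0 ?lexx ?ler01 ?lerN10 ?l01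
    ?lN10 /=; intuition.
Qed.

Lemma sgn_cases h x : sgn h x = 0 \/ sgn h x = 1 \/ sgn h x = -1.
Proof. by rewrite /sgn; case: sgrP; auto. Qed.

(** A hyperplane through [z] contributes both of its halfspaces, any other one only the side of
    [z]. *)
Definition cell_halfspaces A z :=
  [seq h <- A | sgn h z != 1] ++ [seq opp_half h | h <- A & sgn h z != -1].

Lemma closed_cellE A z : closed_cell A z =
  [set x | forall h, h \in cell_halfspaces A z -> sgn h x <= 0].
Proof.
apply/seteqP; split=> x /= xP.
  move=> h; rewrite mem_cat mem_filter => /orP[/andP[hz hA]|/mapP[g]].
    by have /(sgn_cell _ _ (sgn_cases h z))[/(_ hz)] := xP h hA.
  rewrite mem_filter => /andP[hz hA] ->; rewrite sgn_opp_half oppr_le0.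
  by have /(sgn_cell _ _ (sgn_cases g z))[_ /(_ hz)] := xP g hA.
move=> h hA; apply/(sgn_cell _ _ (sgn_cases h z)); split=> hz.
  by apply: xP; rewrite mem_cat mem_filter hz hA.
rewrite -oppr_le0 -sgn_opp_half; apply: xP; rewrite mem_cat; apply/orP; right.
by apply/mapP; exists h; rewrite ?mem_filter ?hz.
Qed.

Lemma polyhedron_closed_cell A z : integral A -> polyhedron (closed_cell A z).
Proof.
move=> Aint; apply/polyhedron_halfspaces; exists (cell_halfspaces A z).
  move=> h; rewrite mem_cat mem_filter => /orP[/andP[_ /Aint//]|/mapP[g]].
  by rewrite mem_filter => /andP[_ /Aint gi] ->; apply/mxOverP => i j;
    rewrite mxE rpredN; exact: (mxOverP gi).
exact: closed_cellE.
Qed.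

Lemma linspaceE P U : contains_differences P U -> (U <= linspace P)%VS ->
  linspace P = U.
Proof.
move=> PU UP; apply/eqP; rewrite eqEsubv UP andbT.
by case: (linspaceP P) => _; apply.
Qed.

Lemma linspace_diff P x y : P x -> P y -> x - y \in linspace P.
Proof. by case: (linspaceP P) => + _; apply. Qed.

Lemma linspaceS P Q : P `<=` Q -> (linspace P <= linspace Q)%VS.
Proof.
move=> PQ; case: (linspaceP P) => _; apply=> x y /PQ Qx /PQ Qy.
exact: linspace_diff.
Qed.

Lemma push_flat A x v : v \in flat A x -> same_cell A (push A x v) x.
Proof.
by move/flatP => vA h hA; rewrite sgn_push //; case: eqP => // e; rewrite vA // sgr0 e.
Qed.

(** A small push along a vector of the flat stays in the cell of [x], so the vector is a multiple of
    a difference of points of [P]. *)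
Lemma flat_sub_linspace A P x :
  saturated A P -> P x -> (flat A x <= linspace P)%VS.
Proof.
move=> sP Px; apply/subvP => v vA.
have Pv : P (push A x v).
  exact: same_cell_saturated (same_cell_sym (push_flat vA)) Px.
have := linspace_diff Pv Px; rewrite /push addrC addKr.
by rewrite rpredZeq gt_eqF ?push_size_gt0.
Qed.

Lemma linspace_closed_cell A z : linspace (closed_cell A z) = flat A z.
Proof.
apply: linspaceE => [x y|]; first exact: closed_cell_flat.
apply: flat_sub_linspace; last exact: closed_cell_refl.
by case: (tame_closed_cell A z).
Qed.

(** A step from a point of maximal flat toward any [y] in [P] cannot enlarge the flat, which
    therefore contains the direction to [y]. *)
Lemma exists_relint A P : tame A P -> P !=set0 ->
  exists2 z, P z & flat A z = linspace P.
Proof.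
move=> [cP sP] P0; have [z Pz zmax] := exists_max_flat A P0.
exists z => //; apply/esym/linspaceE; last exact: flat_sub_linspace.
suff main y : P y -> y - z \in flat A z.
  move=> x y /main xz /main yz.
  by rewrite -[x - y](subrKA z) -[z - y]opprB rpredB.
move=> Py; have Pc := convex_tits A cP Pz Py.
have -> := zmax _ Pc (flat_sub_push _ _ _).
exact: flat_push.
Qed.

Lemma face_sub F P : face F P -> F `<=` P.
Proof. by move=> [_ [a ->]] x []. Qed.

Lemma face_nonempty F P : face F P -> F !=set0.
Proof. by case. Qed.

(* A functional maximal at an interior point is constant. *)
Lemma face_relint A F P z : saturated A P -> face F P -> F z ->
  flat A z = linspace P -> P `<=` F.
Proof.
move=> sP [_ [a ->]] [Pz zmax] zP y Py; split=> // u Pu.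
apply: le_trans (zmax _ Pu) _; rewrite -/(dot a z) -/(dot a y).
have dA : z - y \in flat A z by rewrite zP linspace_diff.
(* As [z - y] lies in the flat, a small step from [z] away from [y] stays in [P]. The functional
   does not increase along it, so its value at [y] is at least that at [z]. *)
have Pv : P (push A z (z - y)).
  exact: same_cell_saturated (same_cell_sym (push_flat dA)) Pz.
have := zmax _ Pv; rewrite -/(dot a z) -/(dot a (push _ _ _)) /push dotD dotZ.
by rewrite gerDl pmulr_rle0 ?push_size_gt0 // dotB subr_le0.
Qed.

Lemma face_convex F P : convex P -> face F P -> convex F.
Proof.
move=> cP [_ [a ->]] x y t [Px xmax] [Py ymax] t0 t1; split.
  exact: cP.
move=> u Pu; rewrite -/(dot a u) -/(dot a (_ + _)) dotD dotZ dotB.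
have := xmax u Pu; have := ymax u Pu.
rewrite -/(dot a u) -/(dot a x) -/(dot a y) => h1 h2; nra.
Qed.

(** The supporting functional is the sum of the normals of the hyperplanes through [y], each
    oriented away from [z]. Every summand is largest where its hyperplane is met, so the sum is
    largest exactly where all those hyperplanes are met at once. *)
Lemma face_closed_cell A z y : closed_cell A z y ->
  face (closed_cell A y) (closed_cell A z).
Proof.
move=> zy; split; first by exists y; exact: closed_cell_refl.
have [a dota] : exists a, forall x,
    dot a x = \sum_(h <- A | sgn h y == 0) (- sgn h z) * dot h.1 x.
  exists (\sum_(h <- A | sgn h y == 0) (- sgn h z) *: h.1) => x.
  rewrite /dot mulmx_suml summxE; apply: eq_bigr => h _.
  by rewrite -scalemxAl mxE.
have sg_ge0 h x : h \in A -> closed_cell A z x ->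
    0 <= sgn h z * (dot h.1 x - h.2).
  move=> hA /(_ h hA); rewrite -sgr_ge0 sgrM /sgn sgr_id => -[->|->].
    by rewrite mulr0.
  exact: sqr_ge0.
have dot_y h u : sgn h u == 0 -> dot h.1 u = h.2.
  by rewrite sgr_eq0 subr_eq0 => /eqP.
have max_y x : closed_cell A z x -> dot a x <= dot a y.
  move=> zx; rewrite !dota [leLHS]big_seq_cond [leRHS]big_seq_cond.
  apply: ler_sum => h /andP[hA /dot_y ->].
  by rewrite -subr_ge0 -mulrBr mulNr -mulrN opprB sg_ge0.
exists a; apply/seteqP; split=> x.
  move=> yx; split=> [|u /max_y]; first exact: closed_cell_sub zy _ yx.
  move=> /le_trans; apply; rewrite -/(dot a x) !dota.
  rewrite le_eqVlt; apply/orP; left; apply/eqP.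
  rewrite [LHS]big_seq_cond [RHS]big_seq_cond; apply: eq_bigr => h /andP[hA hy].
  rewrite !dot_y //; by case: (yx h hA) => ->.
move=> [zx xmax] h hA.
case: (zy h hA) => hy; last by rewrite hy; exact: zx.
left; apply/eqP; have [hz|hz] := eqVneq (sgn h z) 0.
  by case: (zx h hA) => ->; rewrite ?hz.
have := xmax _ zy; rewrite -/(dot a y) -/(dot a x) -subr_ge0 !dota -sumrB.
have F0 g : g \in A -> sgn g y == 0 ->
    - sgn g z * dot g.1 x - - sgn g z * dot g.1 y <= 0.
  move=> gA /dot_y ->; rewrite -mulrBr mulNr oppr_le0; exact: sg_ge0.
rewrite sgr_eq0.
move=> S0; have : \sum_(g <- A | sgn g y == 0)
   (- sgn g z * dot g.1 x - - sgn g z * dot g.1 y) == 0.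
  by rewrite eq_le S0 andbT big_seq_cond; apply: sumr_le0 => g /andP[]; exact: F0.
rewrite -oppr_eq0 -sumrN big_seq_cond psumr_eq0; last first.
  by move=> g /andP[gA gy]; rewrite oppr_ge0 F0.
move=> /allP/(_ h hA); rewrite hA hy eqxx /= => /eqP/eqP.
rewrite oppr_eq0 -mulrBr mulf_eq0 oppr_eq0 (negPf hz) /= (dot_y h y) ?hy //.
Qed.

Lemma face_of_closed_cell A z F : face F (closed_cell A z) ->
  exists2 y, closed_cell A z y & F = closed_cell A y.
Proof.
move=> Fz; have [cz sz] := tame_closed_cell A z.
have [y Fy Fsub] := convex_sub_closed_cell (face_convex cz Fz) (face_nonempty Fz)
  (face_sub Fz).
have zy := face_sub Fz Fy; exists y => //; apply/seteqP; split=> //.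
have sy : closed_cell A y `<=` closed_cell A z by exact: closed_cell_sub.
case: Fz Fy => _ [a ->] [_ ymax] x yx; split; first exact: sy.
(* [G] is the face of the closed cell of [y] cut out by the functional of [F]. It contains the
   relative interior point [y], hence is the whole closed cell. *)
pose G := [set x | closed_cell A y x /\
  forall u, closed_cell A y u -> (a *m u) 0 0 <= (a *m x) 0 0].
have Gy : G y by split=> [|u /sy/ymax//]; exact: closed_cell_refl.
have Gface : face G (closed_cell A y) by split; [exists y|exists a].
have flat_y : flat A y = linspace (closed_cell A y).
  by rewrite linspace_closed_cell.
have [_ xmax] :=
  face_relint (proj2 (tame_closed_cell A y)) Gface Gy flat_y yx.
move=> u zu; apply: le_trans (ymax _ zu) _.
by apply: xmax; exact: closed_cell_refl.
Qed.

Lemma closed_cell_cap A y z : closed_cell A y `&` closed_cell A z !=set0 ->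
  exists2 x, closed_cell A y x /\ closed_cell A z x &
    closed_cell A y `&` closed_cell A z = closed_cell A x.
Proof.
move=> I0; have cI : convex (closed_cell A y `&` closed_cell A z).
  by move=> u v t [yu zu] [yv zv] t0 t1; split; apply: convex_closed_cell.
have [x [yx zx] sub] := convex_sub_closed_cell cI I0 (@subIsetl _ _ _).
exists x => //; apply/seteqP; split=> // u xu.
by split; [exact: closed_cell_sub yx _ xu|exact: closed_cell_sub zx _ xu].
Qed.

Lemma finite_closed_cells A : finite_set (range (closed_cell A)).
Proof.
pose T := {ffun 'I_(size A) -> 'I_3}.
pose code (e : R) : 'I_3 := if e == 0 then ord0 else if e == 1 then inord 1 else inord 2.
pose f z : T := [ffun i : 'I_(size A) => code (sgn (nth (0, 0) A i) z)].
have code_inj x y h : code (sgn h x) = code (sgn h y) -> sgn h x = sgn h y.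
  have n1 : (-1 == 1 :> R) = false.
    by rewrite eq_sym -subr_eq0 opprK -mulr2n pnatr_eq0.
  rewrite /code; case: (sgn_cases h x) => [->|[->|->]];
    case: (sgn_cases h y) => [->|[->|->]];
    rewrite ?eqxx ?oner_eq0 ?oppr_eq0 ?oner_eq0 ?n1 //=;
    by move=> /(congr1 val); rewrite /= ?inordK.
have fE x y : f x = f y -> closed_cell A x = closed_cell A y.
  move=> /ffunP xy; apply: closed_cell_same => h /(nthP (0, 0))[i iA <-].
  by have := xy (Ordinal iA); rewrite !ffunE; exact: code_inj.
pose g (t : T) := closed_cell A (xget 0 [set z | f z = t]).
apply: (@sub_finite_set _ _ (range g)); last exact/finite_image/finite_finset.
move=> _ [z _ <-]; exists (f z) => //; rewrite /g.
by apply: fE; case: xgetP => [y _ //|/(_ z)]; case.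
Qed.

End Linspace.

(** * Weight functions and equivalence *)

Section Complexes.
Local Open Scope classical_set_scope.
Local Open Scope ring_scope.
Context {R : realType} {n : nat}.
Local Notation V := 'cV[R]_n.
Implicit Types (A H K : seq ('rV[R]_n * R)) (d : nat) (X Y Z : wcomplex R n).
Implicit Types (x y z p q u v : V) (s t P Q F : set V) (w : V -> int).

Definition tame_complex A X := forall s, cells X s -> tame A s.

(** At a point whose flat has dimension [d] at most one facet contributes, and the value is its
    weight. At smaller cells the value has no meaning of its own; it only has to be constant on
    cells. *)
Definition weight_at d X z : int :=
  \sum_(s \in [set s | facet d X s /\ s z]) weight X s.

Lemma face_refl P : P !=set0 -> face P P.
Proof.
move=> P0; split=> //; exists 0; apply/seteqP; split=> [x Px|x []//].
by split=> // y _; rewrite !mul0mx.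
Qed.

Lemma face_subset_cell (C : set (set V)) s t : is_polyhedral_complex C ->
  C s -> C t -> s `<=` t -> face s t.
Proof.
move=> [_ C2 _ C4] Cs Ct st; have [_ s0] := C2 _ Cs.
have e : s `&` t = s by apply/setIidl.
by have := C4 _ _ Cs Ct; rewrite e => /(_ s0)[].
Qed.

(** The common face of [s] and [t] contains a relative interior point of [s], hence all of [s]. *)
Lemma polyhedral_complex_sub_cell A (C : set (set V)) s t z :
  is_polyhedral_complex C -> C s -> C t -> s z -> t z -> tame A s ->
  flat A z = linspace s -> s `<=` t.
Proof.
move=> [_ _ _ C4] Cs Ct sz tz [_ sat] zs.
have [|Fs _] := C4 s t Cs Ct; first by exists z.
by apply: subset_trans (face_relint sat Fs (conj sz tz) zs) _ => x [].
Qed.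

Lemma exists_tame X : is_polyhedral_complex (cells X) ->
  exists2 A, integral A & forall A', {subset A <= A'} -> tame_complex A' X.
Proof.
case=> /finite_seqP[r cr] cP _ _.
have {cP} : forall s, s \in r -> polyhedron s.
  by move=> s sr; have [] := cP s; rewrite ?cr.
rewrite /tame_complex cr; elim: r {cr} => [|s r IH] rP.
  by exists [::] => // A' _ s.
have [A Aint AP] : exists2 A, integral A &
    forall A', {subset A <= A'} -> forall t, [set` r] t -> tame A' t.
  by apply: IH => t tr; apply: rP; rewrite inE tr orbT.
have [B Bint BP] := polyhedron_tame (rP s (mem_head _ _)).
exists (A ++ B) => [h|A' sub t /=].
  by rewrite mem_cat => /orP[/Aint|/Bint].
rewrite inE => /predU1P[->|tr].
  by apply: BP => h hB; rewrite sub // mem_cat hB orbT.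
by apply: AP => // h hA; rewrite sub // mem_cat hA.
Qed.

Section Tame.
Context (A : seq ('rV[R]_n * R)) (d : nat) (X : wcomplex R n).
Hypotheses (XW : is_weighted_complex d X) (Xt : tame_complex A X).

Lemma facet_flat s z : facet d X s -> s z -> \dim (flat A z) = d ->
  flat A z = linspace s.
Proof.
move=> [Xs sd] sz zd; apply/eqP; rewrite eqEdim.
by rewrite (flat_sub_linspace (proj2 (Xt Xs)) sz) zd -/(pdim s) sd /=.
Qed.

Lemma facet_unique s t z : facet d X s -> facet d X t -> s z -> t z ->
  \dim (flat A z) = d -> s = t.
Proof.
move=> fs ft sz tz zd; case: XW => XP _.
have zs := facet_flat fs sz zd; have zt := facet_flat ft tz zd.
case: fs ft => [Xs _] [Xt' _]; apply/seteqP; split.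
  exact: polyhedral_complex_sub_cell XP Xs Xt' sz tz (Xt Xs) zs.
exact: polyhedral_complex_sub_cell XP Xt' Xs tz sz (Xt Xt') zt.
Qed.

Lemma dim_flat_le s z : cells X s -> s z -> (\dim (flat A z) <= d)%N.
Proof.
case: XW => _ pur Xs sz; have [t [Xt' <-] st] := pur _ Xs.
apply: dimvS; apply: flat_sub_linspace (st _ sz).
by case: (Xt Xt').
Qed.

Lemma facet_relint s : facet d X s ->
  exists2 z, s z & \dim (flat A z) = d /\ flat A z = linspace s.
Proof.
case: XW => -[_ XP _ _] _ [Xs sd].
have [z sz e] := exists_relint (Xt Xs) (proj2 (XP _ Xs)).
by exists z; rewrite // e.
Qed.

Lemma weight_at_facet s z : facet d X s -> s z -> \dim (flat A z) = d ->
  weight_at d X z = weight X s.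
Proof.
move=> fs sz zd; rewrite /weight_at.
rewrite (_ : [set _ | _] = [set s]) ?fsbig_set1 //.
apply/seteqP; split=> t /= => [[ft tz]|->//].
exact: facet_unique ft fs tz sz zd.
Qed.

Lemma weight_at_neq0 z : weight_at d X z != 0 ->
  exists s, [/\ facet d X s, s z & weight X s != 0].
Proof.
rewrite /weight_at => h.
have [s [fs sz] ws] := @fsbigN1 _ 0 _ unit _ _ (fun _ s => weight X s) tt h.
by exists s.
Qed.

Lemma weight_at_same_cell x y : same_cell A x y -> weight_at d X x = weight_at d X y.
Proof.
move=> xy; rewrite /weight_at; congr (\sum_(s \in _) _).
apply/seteqP; split=> s [fs sx]; split=> //; case: (Xt (proj1 fs)) => _ sat.
  exact: same_cell_saturated xy sx.
exact: same_cell_saturated (same_cell_sym xy) sx.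
Qed.

Lemma discard_zero_cell t : cells (discard_zero d X) t -> cells X t.
Proof. by case: XW => -[_ _ XF _] _ [s [[Xs _] _ ts]]; exact: XF ts. Qed.

(** A facet that is a face of another facet equals it, so no facet of weight zero survives as a face
    of a facet of non-zero weight. *)
Lemma facet_discard_zero s :
  facet d (discard_zero d X) s <-> facet d X s /\ weight X s != 0.
Proof.
case: XW => XP _; split=> [[Xs sd]|[fs ws]].
  have fs : facet d X s by split=> //; exact: discard_zero_cell.
  case: Xs => t [ft wt st]; have [z sz [zd _]] := facet_relint fs.
  by rewrite (facet_unique fs ft sz (face_sub st sz) zd).
split; last by case: fs.
exists s; split=> //; apply: face_refl.
by case: XP fs => _ XP _ _ [/XP[]].
Qed.

Lemma discard_zero_weighted : is_weighted_complex d (discard_zero d X).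
Proof.
have sub := discard_zero_cell.
case: (XW) => XP _; case: (XP) => X1 X2 X3 X4; split.
  split=> [|s /sub/X2//|s t Zs ts|s t /sub Xs /sub Xt']; last exact: X4.
    exact: sub_finite_set X1.
  case: (Zs) => r [fr wr sr]; exists r; split=> //.
  apply: (face_subset_cell XP); [exact: X3 (sub _ Zs) ts|by case: fr|].
  by apply: subset_trans (face_sub ts) (face_sub sr).
move=> s [r [fr wr sr]]; exists r; first exact/facet_discard_zero.
exact: face_sub.
Qed.

End Tame.

(** If [z] lies in the common union, the cell of [X] that contains the refining facet through [z]
    can only be the facet of [X] through [z], and refinement preserves weights. Otherwise both sides
    vanish. *)
Lemma refines_weight_at A d X Z z : is_weighted_complex d X -> tame_complex A X ->
  is_weighted_complex d Z -> tame_complex A Z ->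
  refines d Z (discard_zero d X) -> \dim (flat A z) = d ->
  weight_at d Z z = weight_at d X z.
Proof.
move=> XW Xt ZW Zt [ZU Zsub Zw] zd.
have [e|] := pselect ((\bigcup_(s in cells Z) s) z).
  have [r [s [fs ws rs]] rz] : (\bigcup_(s in cells (discard_zero d X)) s) z.
    by rewrite -ZU.
  have sz := face_sub rs rz.
  case: e => u Zu uz; have [u' fu' uu'] := proj2 ZW _ Zu.
  have [t Xt' u't] := Zsub _ (proj1 fu').
  have tz := u't _ (uu' _ uz).
  have ft : facet d (discard_zero d X) t.
    apply/(facet_discard_zero XW Xt); suff -> : t = s by [].
    have Xt1 := discard_zero_cell XW Xt'.
    case: Xt' => s' [fs' ws' ts'].
    have e := facet_unique XW Xt fs' fs (face_sub ts' tz) sz zd.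
    rewrite e in ts'; apply/seteqP; split; first exact: face_sub.
    apply: (face_relint (proj2 (Xt _ (proj1 fs))) ts' tz).
    by rewrite (facet_flat Xt fs sz zd).
  have /(facet_discard_zero XW Xt)[ft1 _] := ft.
  rewrite (weight_at_facet ZW Zt fu' (uu' _ uz) zd).
  by rewrite (weight_at_facet XW Xt ft1 tz zd) (Zw _ _ fu' ft u't).
move=> nz; have -> : weight_at d Z z = 0.
  apply/eqP/negPn/negP => /weight_at_neq0[s [[Zs _] sz _]].
  by apply: nz; exists s.
apply/esym/eqP/negPn/negP => /weight_at_neq0[s [fs sz ws]].
apply: nz; rewrite ZU; exists s => //.
by have /(facet_discard_zero XW Xt)[] : facet d X s /\ weight X s != 0.
Qed.

(** * The pure complex carried by an arrangement *)

Definition arr_cells A d : set (set V) :=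
  [set s | exists x z, [/\ s = closed_cell A x, closed_cell A z x &
                          \dim (flat A z) = d]].

(** The weight is read at an arbitrary point with the given closed cell, which is harmless for a
    constructible [w]. The value 0 off the cells makes the union of two such complexes literally the
    complex of the sum. *)
Definition arr_complex A d w : wcomplex R n :=
  WComplex (arr_cells A d) (fun s => if `[< arr_cells A d s >] then
     w (xget 0 [set z | s = closed_cell A z]) else 0).

Definition constructible A w := forall x y, same_cell A x y -> w x = w y.

Lemma arr_facet A d w z : facet d (arr_complex A d w) (closed_cell A z) <->
  \dim (flat A z) = d.
Proof.
rewrite /facet /pdim linspace_closed_cell; split=> [[]//|zd]; split=> //.
by exists z, z; split=> //; exact: closed_cell_refl.
Qed.

Lemma arr_facetP A d w s : facet d (arr_complex A d w) s ->
  exists2 z, s = closed_cell A z & \dim (flat A z) = d.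
Proof.
by move=> fs; case: (fs) => -[x [z [sx _ _]] _]; exists x => //;
  apply/(@arr_facet _ _ w); rewrite -sx.
Qed.

Lemma arr_weight A d w z : constructible A w -> \dim (flat A z) = d ->
  weight (arr_complex A d w) (closed_cell A z) = w z.
Proof.
move=> wc /(@arr_facet _ _ w)[cz _] /=; rewrite (asboolT cz).
by apply: wc; apply: closed_cell_inj; case: xgetP => [y _ <-|/(_ z)/= []].
Qed.

Lemma arr_weighted A d w : integral A -> is_weighted_complex d (arr_complex A d w).
Proof.
move=> Aint; split=> [|s [x [z [-> zx zd]]]]; last first.
  by exists (closed_cell A z); [exact/arr_facet|exact: closed_cell_sub].
split=> [|s [x [z [-> _ _]]]|s F [x [z [-> zx zd]]]|].
- by apply: sub_finite_set (finite_closed_cells A) => s [x [z [-> _ _]]]; exists x.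
- split; first exact: polyhedron_closed_cell.
  by exists x; exact: closed_cell_refl.
- move=> /face_of_closed_cell[y xy ->]; exists y, z; split=> //.
  exact: closed_cell_sub zx _ xy.
move=> s t [x [z [-> _ _]]] [x' [z' [-> _ _]]] /closed_cell_cap[y [xy x'y] ->].
by split; exact: face_closed_cell.
Qed.

Lemma arr_tame A d w : tame_complex A (arr_complex A d w).
Proof. by move=> s [x [z [-> _ _]]]; exact: tame_closed_cell. Qed.

Lemma weight_at_arr A d w z : integral A -> constructible A w ->
  \dim (flat A z) = d -> weight_at d (arr_complex A d w) z = w z.
Proof.
move=> Aint wc zd; have fz := (@arr_facet A d w z).2 zd.
rewrite (weight_at_facet (arr_weighted d w Aint) (@arr_tame A d w) fz) //.
  exact: arr_weight.
exact: closed_cell_refl.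
Qed.

Lemma arr_refines A d X w : integral A -> is_weighted_complex d X ->
  tame_complex A X -> constructible A w ->
  (forall z, \dim (flat A z) = d -> w z = weight_at d X z) ->
  refines d (discard_zero d (arr_complex A d w)) (discard_zero d X).
Proof.
move=> Aint XW Xt wc wX; set Y := arr_complex A d w.
have YW : is_weighted_complex d Y by exact: arr_weighted.
have Yt : tame_complex A Y by exact: arr_tame.
have sub s : facet d Y s -> weight Y s != 0 ->
    exists t, [/\ facet d X t, weight X t != 0 & s `<=` t].
  move=> fs; have [z e zd] := arr_facetP fs; subst s.
  rewrite arr_weight // wX // => /weight_at_neq0[t [ft tz wt]].
  exists t; split=> //; case: (Xt _ (proj1 ft)) => _ sat x; exact: sat tz.
have cellX t : facet d X t -> weight X t != 0 -> cells (discard_zero d X) t.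
  by move=> ft wt; case: ((facet_discard_zero XW Xt t).2 (conj ft wt)).
split.
- apply/seteqP; split=> x.
    move=> [r [s [fs ws /face_sub rs]] /rs sx].
    by have [t [ft wt /(_ _ sx) tx]] := sub _ fs ws; exists t => //; exact: cellX.
  move=> [r [s [fs ws /face_sub rs]] /rs sx].
  have [z0 sz0 [z0d z0s]] := facet_relint XW Xt fs.
  have [cs sat] := Xt _ (proj1 fs).
  (* A short step from [x] toward a relative interior point of [s] reaches a [d]-dimensional cell
     inside [s] that has [x] in its closure. *)
  pose z := tits A x z0.
  have sz : s z by exact: convex_tits.
  have zd : \dim (flat A z) = d.
    apply/eqP; rewrite eqn_leq (dim_flat_le XW Xt (proj1 fs) sz) /=.
    by rewrite -z0d dimvS // flat_sub_tits.
  exists (closed_cell A z); last exact: closed_cell_push.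
  suff /(facet_discard_zero YW Yt)[] :
    facet d Y (closed_cell A z) /\ weight Y (closed_cell A z) != 0 by [].
  split; first exact/arr_facet.
  by rewrite arr_weight // wX // (weight_at_facet XW Xt fs sz zd).
- move=> r [s [fs ws /face_sub rs]]; have [t [ft wt st]] := sub _ fs ws.
  by exists t; [exact: cellX|exact: subset_trans rs st].
move=> s t /(facet_discard_zero YW Yt)[fs ws] /(facet_discard_zero XW Xt)[ft wt] st.
have [z e zd] := arr_facetP fs; subst s.
rewrite [LHS]arr_weight // wX //.
by rewrite (weight_at_facet XW Xt ft (st _ (closed_cell_refl _)) zd).
Qed.

(** The complex of the arrangement with the common weight function, with its zero facets discarded,
    refines both. *)
Lemma weight_at_equivalent A d X Y : integral A ->
  is_weighted_complex d X -> tame_complex A X ->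
  is_weighted_complex d Y -> tame_complex A Y ->
  (forall z, \dim (flat A z) = d -> weight_at d X z = weight_at d Y z) ->
  equivalent d X Y.
Proof.
move=> Aint XW Xt YW Yt XY.
have wc : constructible A (weight_at d X) by move=> x y; exact: weight_at_same_cell.
exists (discard_zero d (arr_complex A d (weight_at d X))); split.
- apply: discard_zero_weighted; first exact: arr_weighted.
  exact: arr_tame.
- exact: arr_refines.
exact: arr_refines.
Qed.

(** The statement covers all larger arrangements, so that two equivalences can be read on a common
    one. *)
Lemma equivalent_weight_at d X Y : is_weighted_complex d X ->
  is_weighted_complex d Y -> equivalent d X Y ->
  exists2 A, integral A & forall A', {subset A <= A'} ->
    [/\ tame_complex A' X, tame_complex A' Y & forall z, \dim (flat A' z) = d ->
      weight_at d X z = weight_at d Y z].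
Proof.
move=> XW YW [Z [ZW ZX ZY]].
have [A Aint AP] := exists_tame (proj1 XW).
have [B Bint BP] := exists_tame (proj1 YW).
have [C Cint CP] := exists_tame (proj1 ZW).
exists (A ++ B ++ C) => [h|A' sub].
  by rewrite !mem_cat => /or3P[/Aint|/Bint|/Cint].
have Xt : tame_complex A' X by apply: AP => h hA; rewrite sub // !mem_cat hA.
have Yt : tame_complex A' Y by apply: BP => h hB; rewrite sub // !mem_cat hB orbT.
have Zt : tame_complex A' Z by apply: CP => h hC; rewrite sub // !mem_cat hC !orbT.
split=> // z zd.
rewrite -(refines_weight_at XW Xt ZW Zt ZX zd).
exact: refines_weight_at YW Yt ZW Zt ZY zd.
Qed.

Lemma equivalent_sym d X Y : equivalent d X Y -> equivalent d Y X.
Proof. by move=> [Z [ZW ZX ZY]]; exists Z; split. Qed.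

Lemma equivalent_trans d X Y Z : is_weighted_complex d X ->
  is_weighted_complex d Y -> is_weighted_complex d Z ->
  equivalent d X Y -> equivalent d Y Z -> equivalent d X Z.
Proof.
move=> XW YW ZW /(equivalent_weight_at XW YW)[A Aint AP].
move=> /(equivalent_weight_at YW ZW)[B Bint BP].
have ABint : integral (A ++ B) by move=> h; rewrite mem_cat => /orP[/Aint|/Bint].
have [|Xt Yt XY] := AP (A ++ B); first by move=> h hA; rewrite mem_cat hA.
have [|_ Zt YZ] := BP (A ++ B); first by move=> h hB; rewrite mem_cat hB orbT.
by apply: (weight_at_equivalent ABint) => // z zd; rewrite XY ?YZ.
Qed.

Lemma cycle_class_equivalent d X Y : is_weighted_complex d X ->
  is_weighted_complex d Y -> equivalent d X Y -> cycle_class d X = cycle_class d Y.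
Proof.
move=> XW YW XY; apply/seteqP; split=> Z [ZT].
  by move=> XZ; split=> //; apply: equivalent_trans (equivalent_sym XY) XZ => //;
    case: ZT.
by move=> YZ; split=> //; apply: equivalent_trans XY YZ => //; case: ZT.
Qed.

End Complexes.

(** * Balancing at a ridge *)

Section Balancing.
Local Open Scope classical_set_scope.
Local Open Scope ring_scope.
Context {R : realType} {n : nat}.
Local Notation V := 'cV[R]_n.
Implicit Types (A : seq ('rV[R]_n * R)) (d : nat) (X Y Z : wcomplex R n).
Implicit Types (x y z p q u v : V) (s t P Q F : set V) (w G : V -> int).
Implicit Types (U : {vspace V}) (D : seq V).

Definition same_ray U u v := exists2 c : R, 0 < c & u - c *: v \in U.

(** The conditions of [is_primitive_generator], with the two cells replaced by a linear space and a
    direction. *)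
Definition primitive_on U v : set V := [set p |
  [/\ p \is a mxOver Num.int, p \notin U,
      exists2 c : R, 0 <= c & p - c *: v \in U
    & forall (k : nat) (q : V), q \is a mxOver Num.int ->
        p - k%:R *: q \in U -> k = 1%N]].

Definition primitive_vector U v : V := xget 0 (primitive_on U v).

(* [G] is thought of as the germ of a weight function at a point of a ridge with
   linear span [U]: its value at [v] is the weight of the facet in direction [v].
   This phrases balancing without mentioning cells. *)
Definition ray_representatives U G D := [/\ uniq D, {in D, forall v, v \notin U},
  {in D &, forall u v, same_ray U u v -> u = v} &
  forall v, v \notin U -> G v != 0 -> exists2 u, u \in D & same_ray U v u].

Definition balanced_germ U G := exists2 D, ray_representatives U G D &
  \sum_(v <- D) (G v)%:~R *: primitive_vector U v \in U.

Lemma same_ray_sym U u v : same_ray U u v -> same_ray U v u.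
Proof.
move=> [c c0 uv]; exists c^-1; first by rewrite invr_gt0.
have : - c^-1 *: (u - c *: v) \in U by rewrite rpredZ.
by rewrite scalerBr scalerA mulNr mulVf ?gt_eqF // scaleN1r opprK addrC scaleNr.
Qed.

Lemma same_ray_trans U u v z : same_ray U u v -> same_ray U v z -> same_ray U u z.
Proof.
move=> [c c0 uv] [e e0 vz]; exists (c * e); first by rewrite mulr_gt0.
have -> : u - (c * e) *: z = (u - c *: v) + c *: (v - e *: z).
  by rewrite scalerBr addrA subrK scalerA.
by rewrite rpredD // rpredZ.
Qed.

Lemma same_ray_scale U u (c : R) : 0 < c -> same_ray U (c *: u) u.
Proof. by move=> c0; exists c; rewrite // subrr rpred0. Qed.

Lemma primitive_on_same_ray U u v :
  same_ray U u v -> primitive_on U u = primitive_on U v.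
Proof.
have main u1 v1 : same_ray U u1 v1 -> primitive_on U u1 `<=` primitive_on U v1.
  move=> [c c0 uv] p [pint pU [e e0 pe] pk]; split=> //.
  exists (e * c); first by rewrite mulr_ge0 // ltW.
  have -> : p - (e * c) *: v1 = (p - e *: u1) + e *: (u1 - c *: v1).
    by rewrite scalerBr addrA subrK scalerA.
  by rewrite rpredD // rpredZ.
by move=> uv; apply/seteqP; split; apply: main => //; exact: same_ray_sym.
Qed.

Lemma dimv_lt U W v : (U <= W)%VS -> v \in W -> v \notin U -> (\dim U < \dim W)%N.
Proof.
move=> UW vW vU; rewrite ltn_neqAle (dimvS UW) andbT.
by apply: contraNneq vU => e; have /eqP -> : (U == W) by rewrite eqEdim UW e /=.
Qed.

(** * A cell modulo one of its ridges *)

Section Ridge.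
Context (s t : set V) (x z : V).
Hypotheses (ts : face t s) (dim_s : pdim s = (pdim t).+1).
Hypotheses (tx : t x) (sz : s z) (tz : ~ t z).

Lemma ridge_functional : exists2 a : 'rV[R]_n,
  forall u, u \in linspace t -> dot a u = 0 &
  forall y, s y -> dot a y <= dot a x /\ (~ t y -> dot a y < dot a x).
Proof.
have [_ [a te]] := ts; exists a => [u|y sy].
  have ker_diff : contains_differences t (lker (linfun (mulmx a : V -> 'cV_1))).
    move=> y y'; rewrite te => -[sy ymax] [sy' y'max].
    rewrite memv_ker lfunE /=; apply/eqP/matrixP => i j; rewrite !ord1 [RHS]mxE.
    apply/eqP; rewrite -/(dot a (y - y')) dotB subr_eq0 eq_le.
    by apply/andP; split; [exact: y'max|exact: ymax].
  move=> /(subvP (proj2 (linspaceP t) _ ker_diff)).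
  by rewrite memv_ker lfunE /= /dot => /eqP ->; rewrite mxE.
move: (tx); rewrite te => -[_ xmax]; split; first exact: xmax.
move=> nty; rewrite lt_neqAle (xmax y sy : dot a y <= dot a x) andbT.
apply/eqP => e; apply: nty; split=> // u su.
by apply: le_trans (xmax u su) _; rewrite -/(dot a x) -e.
Qed.

Lemma ridge_notin_linspace : z - x \notin linspace t.
Proof.
have [a at0 amax] := ridge_functional; apply/negP => /at0.
by rewrite dotB => /eqP; rewrite subr_eq0 lt_eqF //; apply: (amax z sz).2.
Qed.

(** Since [t] has codimension one in [s], the span of [s] is that of [t] plus the line of [z - x].
    The functional that cuts out [t] fixes the sign of the coefficient. *)
Lemma ridge_ray y y' : s y -> t y' -> exists c : R,
  [/\ 0 <= c, (y - y') - c *: (z - x) \in linspace t & ~ t y -> 0 < c].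
Proof.
move=> sy ty'; have [a at0 amax] := ridge_functional.
have sx := face_sub ts tx; have sy' := face_sub ts ty'.
have lin_s : linspace s = (linspace t + <[z - x]>)%VS.
  apply/esym/eqP; rewrite eqEdim subv_add (linspaceS (face_sub ts)) /=.
  rewrite -memvE linspace_diff //= -/(pdim s) dim_s; apply: dimv_lt.
  - exact: addvSl.
  - exact: subvP (addvSr _ _) _ (memv_line _).
  exact: ridge_notin_linspace.
have: y - y' \in linspace s by exact: linspace_diff.
rewrite lin_s => /memv_addP[u ut [_ /vlineP[c ->] e]]; exists c.
have ay' : dot a y' = dot a x.
  by apply/eqP; rewrite -subr_eq0 -dotB at0 // linspace_diff.
have E : dot a y - dot a x = c * (dot a z - dot a x).
  by rewrite -{1}ay' -dotB e dotD dotZ at0 // add0r dotB.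
have [az1 /(_ tz) az] := amax z sz; have [ay aty] := amax y sy.
split; first nra.
  by rewrite e addrK.
by move=> /aty ayx; nra.
Qed.

Lemma same_ray_ridge y : s y -> ~ t y -> same_ray (linspace t) (y - x) (z - x).
Proof.
by move=> sy ty; have [c [_ yc c0]] := ridge_ray sy tx; exists c => //; exact: c0.
Qed.

(** The two defining predicates coincide, so both sides choose the very same vector, not merely one
    congruent to it. *)
Lemma primitive_generator_ridge :
  primitive_generator s t = primitive_vector (linspace t) (z - x).
Proof.
rewrite /primitive_generator /primitive_vector; congr (xget 0 _).
apply/seteqP; split=> p [pint pt [c]].
  move=> [y [y' [c0 sy ty' py]]] pk; split=> //.
  have [e [e0 ye _]] := ridge_ray sy ty'; exists (c * e); first exact: mulr_ge0.
  have -> : p - (c * e) *: (z - x) =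
      (p - c *: (y - y')) + c *: ((y - y') - e *: (z - x)).
    by rewrite [c *: (_ - e *: _)]scalerBr addrA subrK scalerA.
  by rewrite rpredD // rpredZ.
move=> c0 pc pk; split=> //; exists c, z, x; split=> //.
Qed.

End Ridge.

Lemma push_same_ray A x u v :
  same_ray (flat A x) u v -> same_cell A (push A x u) (push A x v).
Proof.
move=> [c c0 /flatP uv] h hA; rewrite !sgn_push //; case: eqP => // hx.
have /eqP := uv h hA hx; rewrite dotB dotZ subr_eq0 => /eqP ->.
by rewrite sgrM (gtr0_sg c0) mul1r.
Qed.

Lemma push_sub A x v : push A x v - x = push_size A x v *: v.
Proof. by rewrite /push addrC addKr. Qed.

Lemma dim_flat_push A x v :
  v \notin flat A x -> (\dim (flat A x) < \dim (flat A (push A x v)))%N.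
Proof. exact/dimv_lt/flat_push/flat_sub_push. Qed.

Definition germ A w x v := w (push A x v).

(** * Balancing of a complex in terms of germs *)

Section BalancedGerm.
Context (A : seq ('rV[R]_n * R)) (d : nat) (X : wcomplex R n) (t : set V) (x : V).
Hypotheses (XW : is_weighted_complex d X) (Xt : tame_complex A X).
Hypotheses (Ct : cells X t) (dim_t : (pdim t).+1 = d).
Hypotheses (tx : t x) (xt : flat A x = linspace t).

Let G := germ A (weight_at d X) x.

Lemma face_facet s : facet d X s -> s x -> face t s.
Proof.
move=> [Cs _] sx; apply: (face_subset_cell (proj1 XW)) => //.
exact: polyhedral_complex_sub_cell (proj1 XW) Ct Cs tx sx (Xt Ct) xt.
Qed.

Lemma dim_facet s : facet d X s -> pdim s = (pdim t).+1.
Proof. by case=> _ ->. Qed.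

Lemma push_notin v : v \notin linspace t -> ~ t (push A x v).
Proof.
move=> vt tv; have := linspace_diff tv tx.
by rewrite push_sub rpredZeq gt_eqF ?push_size_gt0 //= (negPf vt).
Qed.

Lemma germ_neq0 v : v \notin linspace t -> G v != 0 ->
  \dim (flat A (push A x v)) = d /\
  exists s, [/\ facet d X s, face t s, s (push A x v) & weight X s = G v].
Proof.
move=> vt Gv; have [s [fs sv ws]] := weight_at_neq0 Gv.
have dv : \dim (flat A (push A x v)) = d.
  apply/eqP; rewrite eqn_leq (dim_flat_le XW Xt (proj1 fs) sv) /= -dim_t.
  by rewrite /pdim -xt dim_flat_push // xt.
split=> //; exists s; split=> //; last by rewrite -(weight_at_facet XW Xt fs sv dv).
apply: face_facet => //; case: (Xt (proj1 fs)) => _ sat.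
exact: sat sv (@closed_cell_push _ _ A x v).
Qed.

Lemma germ_facet s z : facet d X s -> face t s -> s z -> \dim (flat A z) = d ->
  [/\ z - x \notin linspace t, s (tits A x z), \dim (flat A (tits A x z)) = d
    & G (z - x) = weight X s].
Proof.
move=> fs ts sz zd.
have tz : ~ t z.
  move=> tz; have := flat_sub_linspace (proj2 (Xt Ct)) tz.
  by move=> /dimvS; rewrite zd -/(pdim t) -dim_t ltnn.
have st : s (tits A x z).
  by apply: (convex_tits _ (proj1 (Xt (proj1 fs)))) => //; exact: (face_sub ts).
have dt : \dim (flat A (tits A x z)) = d.
  apply/eqP; rewrite eqn_leq (dim_flat_le XW Xt (proj1 fs) st) /=.
  by rewrite -[X in (X <= _)%N]zd dimvS // flat_sub_tits.
split=> //; first exact: ridge_notin_linspace ts tx sz tz.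
by rewrite /G /germ -/(tits A x z) (weight_at_facet XW Xt fs st dt).
Qed.

(* A representative [v] corresponds to the facet that contains a small push of
   the ridge along [v]. *)
Lemma sum_ray_representatives D : ray_representatives (linspace t) G D ->
  \sum_(s \in [set s | facet d X s /\ face t s])
     (weight X s)%:~R *: primitive_generator s t =
  \sum_(v <- D) (G v)%:~R *: primitive_vector (linspace t) v.
Proof.
move=> [uD Dt Dray Dcover].
pose F' := [set s | [/\ facet d X s, face t s & weight X s != 0]].
pose D' := [set v | v \in D /\ G v != 0].
rewrite [RHS]fsbig_seq //.
(* Only facets of non-zero weight and directions of non-zero germ correspond to each other; the
   remaining terms are zero. *)
rewrite -(@fsbig_widen _ _ _ _ F'); first last.
- move=> s /= [[fs ts] ns]; have -> : weight X s = 0; last by rewrite scale0r.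
  by apply: contrapT => /eqP ws; apply: ns.
- by move=> s [fs ts _].
rewrite -(@fsbig_widen _ _ _ _ D'); first last.
- move=> v /= [vD nv]; have -> : G v = 0; last by rewrite scale0r.
  by apply: contrapT => /eqP gv; apply: nv.
- by move=> v [].
pose h v := xget set0 [set s | facet d X s /\ s (push A x v)].
have hE v s : \dim (flat A (push A x v)) = d -> facet d X s ->
    s (push A x v) -> h v = s.
  move=> dv fs sv; rewrite /h; case: xgetP => [r _ [fr rv]|/(_ s)/= []//].
  exact: (facet_unique XW Xt fr fs rv sv dv).
have hD v : D' v -> [/\ facet d X (h v), face t (h v), h v (push A x v),
    weight X (h v) = G v & \dim (flat A (push A x v)) = d].
  move=> [vD gv]; have [dv [s [fs ts sv ws]]] := germ_neq0 (Dt _ vD) gv.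
  by rewrite (hE _ s dv fs sv).
(* [h] is injective because two pushes into one facet lie on the same ray modulo the ridge, and
   surjective because [D] covers every ray of non-zero germ. *)
rewrite (@reindex_fsbig _ _ _ _ _ h D' F'); last first.
  split=> [v Dv|u v /set_mem Du /set_mem Dv huv|s [fs ts ws]] /=.
  - have [fv tv _ wv _] := hD _ Dv; split=> //; rewrite wv.
    by case: Dv.
  - have [fu tu su _ _] := hD _ Du; have [fv tv sv _ _] := hD _ Dv.
    have [uD' _] := Du; have [vD' _] := Dv.
    apply: Dray => //; rewrite -huv in sv.
    have := same_ray_ridge tu (dim_facet fu) tx sv (push_notin (Dt _ vD')) su
      (push_notin (Dt _ uD')).
    rewrite !push_sub => uv.
    apply: same_ray_trans (same_ray_trans uv _).
      exact/same_ray_sym/same_ray_scale/push_size_gt0.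
    exact/same_ray_scale/push_size_gt0.
  have [z sz [zd _]] := facet_relint XW Xt fs.
  have [zt st dt Gz] := germ_facet fs ts sz zd.
  have [|u uD' zu] := Dcover _ zt; first by rewrite Gz.
  rewrite -xt in zu; have cell := push_same_ray zu.
  have Gu : G u != 0.
    by rewrite /G /germ -(weight_at_same_cell d Xt cell) -/(germ _ _ _ _) -/G Gz.
  exists u => //; apply: hE => //; first by rewrite -(same_cell_flat cell).
  by case: (Xt (proj1 fs)) => _ sat; exact: same_cell_saturated sat cell st.
apply: eq_fsbigr => v /set_mem Dv; have [fv tv sv -> _] := hD _ Dv.
congr (_ *: _).
rewrite (primitive_generator_ridge tv (dim_facet fv) tx sv); last first.
  by case: Dv => /Dt/push_notin.
rewrite push_sub /primitive_vector.
by rewrite (primitive_on_same_ray (same_ray_scale _ _ (push_size_gt0 _ _ _))).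
Qed.

(** Each facet at the ridge supplies the direction from [x] to one of its relative interior
    points. *)
Lemma exists_ray_representatives : exists D, ray_representatives (linspace t) G D.
Proof.
have fin : finite_set [set s | facet d X s /\ face t s].
  by apply: sub_finite_set (let: And4 f _ _ _ := proj1 XW in f) => s [[]].
have /finite_seqP[r0 rE] := fin.
pose r := undup r0.
have rP s : s \in r <-> facet d X s /\ face t s.
  rewrite mem_undup; split=> [sr|fs].
    by have : [set` r0] s by []; rewrite -rE.
  by have : [set s | facet d X s /\ face t s] s by []; rewrite rE.
pose f s := xget 0 [set z | s z /\ \dim (flat A z) = d].
have fP s : s \in r -> s (f s) /\ \dim (flat A (f s)) = d.
  move=> /rP[fs _]; rewrite /f; case: xgetP => [z _ //|no].
  by have [z sz [zd _]] := facet_relint XW Xt fs; case: (no z).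
have inj s s' : s \in r -> s' \in r -> same_ray (linspace t) (f s - x) (f s' - x) ->
    s = s'.
  move=> sr sr'; have [fs ts] := (rP s).1 sr; have [fs' ts'] := (rP s').1 sr'.
  have [sz zd] := fP _ sr; have [sz' zd'] := fP _ sr'.
  have [_ st dt _] := germ_facet fs ts sz zd.
  have [_ st' dt' _] := germ_facet fs' ts' sz' zd'.
  rewrite -xt => /push_same_ray cell.
  apply: (facet_unique XW Xt fs fs' st _ dt).
  case: (Xt (proj1 fs')) => _ sat.
  exact: same_cell_saturated sat (same_cell_sym cell) st'.
exists [seq f s - x | s <- r]; split.
- rewrite map_inj_in_uniq ?undup_uniq // => s s' sr sr' e.
  by apply: inj => //; rewrite e; exists 1; rewrite // scale1r subrr rpred0.
- move=> _ /mapP[s sr ->]; have [fs ts] := (rP s).1 sr.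
  have [sz zd] := fP _ sr; by have [] := germ_facet fs ts sz zd.
- by move=> _ _ /mapP[s sr ->] /mapP[s' sr' ->] /inj ->.
move=> v vt Gv; have [dv [s [fs ts sv ws]]] := germ_neq0 vt Gv.
have sr : s \in r by apply/rP.
exists (f s - x); first by apply/mapP; exists s.
have [sz zd] := fP _ sr; have [_ st dt _] := germ_facet fs ts sz zd.
have tz : ~ t (f s).
  move=> tz; have := flat_sub_linspace (proj2 (Xt Ct)) tz.
  by move=> /dimvS; rewrite zd -/(pdim t) -dim_t ltnn.
have := same_ray_ridge ts (dim_facet fs) tx sz tz sv (push_notin vt).
rewrite push_sub; apply: same_ray_trans.
exact/same_ray_sym/same_ray_scale/push_size_gt0.
Qed.

Lemma balanced_atE : balanced_at d X t <-> balanced_germ (linspace t) G.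
Proof.
rewrite /balanced_at; split=> [bal|[D repD]]; last first.
  by rewrite (sum_ray_representatives repD).
have [D repD] := exists_ray_representatives; exists D => //.
by rewrite -(sum_ray_representatives repD).
Qed.

End BalancedGerm.

End Balancing.

(** * Balanced functions and their stars *)

Section BalancedFunctions.
Local Open Scope classical_set_scope.
Local Open Scope ring_scope.
Context {R : realType} {n : nat}.
Local Notation V := 'cV[R]_n.
Implicit Types (A : seq ('rV[R]_n * R)) (d : nat) (X Y Z : wcomplex R n).
Implicit Types (x y z p q u v : V) (s t P Q F : set V) (w G : V -> int).
Implicit Types (U W : {vspace V}) (D : seq V).

Lemma primitive_onN U v p : primitive_on U v p -> primitive_on U (- v) (- p).
Proof.
move=> [pint pU [c c0 pc] pk]; split; rewrite ?memvN //.
- by apply/mxOverP => i j; rewrite mxE rpredN; exact: (mxOverP pint).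
- by exists c; rewrite // scalerN -opprD memvN.
move=> k q qint kq; apply: (pk k (- q)).
  by apply/mxOverP => i j; rewrite mxE rpredN; exact: (mxOverP qint).
by rewrite scalerN opprK -memvN opprD.
Qed.

Lemma int_dot a p : a \is a mxOver Num.int -> p \is a mxOver Num.int ->
  dot a p \is a Num.int.
Proof.
move=> /mxOverP aint /mxOverP pint; rewrite /dot mxE.
by apply: rpred_sum => i _; rewrite rpredM.
Qed.

(** An integral normal vanishing on the flat takes integer values of equal sign on [p1] and [p2].
    Divided by their gcd these are [a] and [b], with [b p1] congruent to [a p2]. A Bezout
    combination [q] then satisfies [p1 = a q] and [p2 = b q] modulo the flat; primitivity forces [a]
    and [b] to be units, of the same sign. *)
Lemma primitive_on_unique A x v p1 p2 : integral A ->
  primitive_on (flat A x) v p1 -> primitive_on (flat A x) v p2 ->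
  p1 - p2 \in flat A x.
Proof.
set U := flat A x => Aint [p1int p1U [c1 c10 pc1] pk1] [p2int p2U [c2 c20 pc2] pk2].
have c_gt0 p (c : R) : p \notin U -> 0 <= c -> p - c *: v \in U -> 0 < c.
  move=> pU; rewrite le_eqVlt => /predU1P[<-|//].
  by rewrite scale0r subr0 (negPf pU).
have {}c10 := c_gt0 _ _ p1U c10 pc1; have {}c20 := c_gt0 _ _ p2U c20 pc2.
have [h hA [hx hp1]] : exists2 h, h \in A & sgn h x = 0 /\ dot h.1 p1 != 0.
  apply: contrapT => no; move: p1U => /negP; apply; apply/flatP => h hA hx.
  by apply: contrapT => /eqP hp; apply: no; exists h.
have dotE p (c : R) : p - c *: v \in U -> dot h.1 p = c * dot h.1 v.
  move=> /flatP/(_ h hA hx) /eqP; rewrite dotB dotZ subr_eq0 => /eqP //.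
have e1 := dotE _ _ pc1; have e2 := dotE _ _ pc2.
have hv : dot h.1 v != 0 by move: hp1; rewrite e1 mulf_eq0 negb_or => /andP[].
have /intrP[m1 m1E] := int_dot (Aint _ hA) p1int.
have /intrP[m2 m2E] := int_dot (Aint _ hA) p2int.
have m1n0 : m1 != 0 by apply: contraNneq hp1 => m0; rewrite m1E m0.
have mU : m2%:~R *: p1 - m1%:~R *: p2 \in U.
  rewrite -m2E -m1E e1 e2.
  have -> : (c2 * dot h.1 v) *: p1 - (c1 * dot h.1 v) *: p2 =
    dot h.1 v *: (c2 *: (p1 - c1 *: v) - c1 *: (p2 - c2 *: v)).
    by apply/matrixP => i j; rewrite !mxE; ring.
  by rewrite rpredZ // rpredB // rpredZ.
have sgm : 0 < m1%:~R * m2%:~R :> R.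
  rewrite -m1E -m2E e1 e2 mulrACA -[X in _ * X]expr2.
  by apply: mulr_gt0; [exact: mulr_gt0|rewrite exprn_even_gt0].
pose g := gcdz m1 m2.
have g0 : g != 0 by rewrite gcdz_eq0 (negPf m1n0).
have [a aE] : exists a, m1 = a * g by apply/dvdzP; exact: dvdz_gcdl.
have [b bE] : exists b, m2 = b * g by apply/dvdzP; exact: dvdz_gcdr.
have [r [r' rE]] := Bezoutz m1 m2.
have ab1 : r * a + r' * b = 1.
  by apply: (mulIf g0); rewrite mul1r mulrDl -!mulrA -aE -bE.
have abU : b%:~R *: p1 - a%:~R *: p2 \in U.
  have : g%:~R *: (b%:~R *: p1 - a%:~R *: p2) \in U.
    by rewrite scalerBr !scalerA -!intrM ![g * _]mulrC -aE -bE.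
  by rewrite rpredZeq intr_eq0 (negPf g0).
pose q := r%:~R *: p1 + r'%:~R *: p2.
have int_scale (e : int) p : p \is a mxOver Num.int -> e%:~R *: p \is a mxOver Num.int.
  by move=> /mxOverP pint; apply/mxOverP => i j; rewrite mxE rpredM // intr_int.
have qint : q \is a mxOver Num.int.
  apply/mxOverP => i j; rewrite mxE rpredD //.
    exact: (mxOverP (int_scale r _ p1int)).
  exact: (mxOverP (int_scale r' _ p2int)).
(* Primitivity speaks of natural multiples only, so the sign of [e] is moved into the integral
   vector. *)
have abs1 (e : int) p : (forall (k : nat) q, q \is a mxOver Num.int ->
    p - k%:R *: q \in U -> k = 1%N) -> p - e%:~R *: q \in U -> `|e|%N = 1%N.
  move=> pk pe; apply: (pk _ ((sgz e)%:~R *: q)); first exact: int_scale.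
  rewrite scalerA (_ : _ * _ = e%:~R) //.
  by rewrite -[`|e|%:R]/(`|e|%:Z%:~R) -intrM mulrC -intEsg.
have one_a : 1 = r%:~R * a%:~R + r'%:~R * b%:~R :> R.
  by rewrite -!intrM -intrD ab1.
have a1 : `|a|%N = 1%N.
  apply: (abs1 _ p1) => //; have -> : p1 - a%:~R *: q =
      r'%:~R *: (b%:~R *: p1 - a%:~R *: p2).
    rewrite -{1}[p1]scale1r {1}one_a /q; apply/matrixP => i j; rewrite !mxE; ring.
  by rewrite rpredZ.
have b1 : `|b|%N = 1%N.
  apply: (abs1 _ p2) => //; have -> : p2 - b%:~R *: q =
      (- r%:~R) *: (b%:~R *: p1 - a%:~R *: p2).
    rewrite -{1}[p2]scale1r {1}one_a /q; apply/matrixP => i j; rewrite !mxE; ring.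
  by rewrite rpredZ.
have abpos : 0 < a * b.
  move: sgm; rewrite -intrM ltr0z aE bE mulrACA pmulr_lgt0 //.
  by rewrite -expr2 exprn_even_gt0.
have aabs : a = 1 \/ a = -1 by move: a1; case: (a) => [[|[|]]|[|]] //; auto.
have babs : b = 1 \/ b = -1 by move: b1; case: (b) => [[|[|]]|[|]] //; auto.
case: aabs babs abpos abU => -> [->|->] //= _.
  by rewrite !scale1r.
by rewrite !scaleN1r -opprD memvN.
Qed.

Lemma primitive_vectorN A x v : integral A ->
  primitive_vector (flat A x) v + primitive_vector (flat A x) (- v) \in flat A x.
Proof.
move=> Aint; set U := flat A x; rewrite /primitive_vector.
(* A primitive vector exists for [v] exactly when one exists for [- v]. If there is none, both
   choices are the default 0. *)
case: xgetP => [p _ pv|no]; case: xgetP => [p' _ p'v|no'].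
- rewrite -[p']opprK; apply: primitive_on_unique Aint pv _.
  by rewrite -[v]opprK; exact: primitive_onN.
- by case: (no' (- p)); exact: primitive_onN.
- by case: (no (- p')); rewrite -[v]opprK; exact: primitive_onN.
by rewrite addr0 rpred0.
Qed.

Lemma eq_balanced_germ U G G' : (forall v, v \notin U -> G v = G' v) ->
  balanced_germ U G -> balanced_germ U G'.
Proof.
move=> GG' [D [uD DU Dray Dcover] S]; exists D.
  by split=> // v vU G'v; apply: Dcover; rewrite // GG'.
by rewrite (eq_big_seq (fun v => (G v)%:~R *: primitive_vector U v)) // => v /DU/GG' ->.
Qed.

Lemma balanced_germ0 U G : (forall v, v \notin U -> G v = 0) -> balanced_germ U G.
Proof.
move=> G0; exists [::]; last by rewrite big_nil rpred0.
by split=> // v vU; rewrite G0 ?eqxx.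
Qed.

Lemma balanced_germ_scale U G (c : int) :
  balanced_germ U G -> balanced_germ U (fun v => c * G v).
Proof.
move=> [D [uD DU Dray Dcover] S]; exists D.
  split=> // v vU; rewrite mulf_eq0 negb_or => /andP[_]; exact: Dcover.
have -> : \sum_(v <- D) (c * G v)%:~R *: primitive_vector U v =
    c%:~R *: \sum_(v <- D) (G v)%:~R *: primitive_vector U v.
  by rewrite scaler_sumr; apply: eq_bigr => v _; rewrite scalerA intrM.
by rewrite rpredZ.
Qed.

(** Such a germ consists of two opposite rays of equal weight, whose primitive vectors cancel. *)
Lemma balanced_germ_linear A x W G (c : int) : integral A ->
  (flat A x <= W)%VS -> \dim W = (\dim (flat A x)).+1 ->
  (forall v, v \in W -> v \notin flat A x -> G v = c) ->
  (forall v, v \notin W -> G v = 0) -> balanced_germ (flat A x) G.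
Proof.
set U := flat A x => Aint UW dimW GW G0.
have [v vW vU] : exists2 v, v \in W & v \notin U.
  apply: contrapT => no; suff /dimvS : (W <= U)%VS by rewrite dimW ltnn.
  by apply/subvP => v vW; apply: contrapT => /negP vU; apply: no; exists v.
have WE : W = (U + <[v]>)%VS.
  apply/esym/eqP; rewrite eqEdim subv_add UW -memvE vW /= dimW.
  by apply: dimv_lt vU; [exact: addvSl|exact: subvP (addvSr _ _) _ (memv_line _)].
have not_opp (e : R) : 0 < e -> v - e *: - v \notin U.
  move=> e0; rewrite scalerN opprK -{1}[v]scale1r -scalerDl rpredZeq.
  by rewrite gt_eqF ?addr_gt0.
exists [:: v; - v].
  split.
  - rewrite /= inE andbT; apply/eqP => e; have := not_opp 1 ltr01.
    by rewrite scale1r -e subrr rpred0.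
  - by move=> u; rewrite !inE => /orP[] /eqP ->; rewrite ?memvN.
  - move=> u u'; rewrite !inE => /orP[] /eqP -> /orP[] /eqP -> // [e e0].
      by rewrite (negPf (not_opp _ e0)).
    have -> : - v - e *: v = - (v - e *: - v) by rewrite scalerN opprK opprD.
    by rewrite memvN (negPf (not_opp _ e0)).
  move=> u uU Gu; have: u \in W.
    by apply: contrapT => /negP uW; rewrite G0 ?eqxx in Gu.
  rewrite WE => /memv_addP[u' u'U [_ /vlineP[e ->] uE]].
  case: (ltrgtP e 0) => e0.
  - exists (- v); first by rewrite !inE eqxx orbT.
    exists (- e); first by rewrite oppr_gt0.
    by rewrite scalerN scaleNr opprK uE addrK.
  - exists v; first by rewrite mem_head.
    by exists e => //; rewrite uE addrK.
  by move: uU; rewrite uE e0 scale0r addr0 u'U.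
rewrite big_cons big_seq1 !GW ?memvN // -scalerDr rpredZ //.
exact: primitive_vectorN.
Qed.

(** The condition is imposed at every cell of [A] of dimension [d - 1], whether or not it lies on a
    ridge; in this form it passes to stars. *)
Definition balanced_function A d w := forall x, (\dim (flat A x)).+1 = d ->
  balanced_germ (flat A x) (germ A w x).

Definition small_support A d w := forall x, w x != 0 -> (\dim (flat A x) <= d)%N.

Lemma arr_tropical A d w : integral A -> constructible A w ->
  small_support A d w -> balanced_function A d w ->
  is_tropical_complex d (arr_complex A d w).
Proof.
move=> Aint wc wd bal; set X := arr_complex A d w.
have XW : is_weighted_complex d X by exact: arr_weighted.
have Xt : tame_complex A X by exact: arr_tame.
split=> // t Ct dt; have [x [z [tE xz zd]]] := Ct; subst t.
have tx := @closed_cell_refl _ _ A x.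
have xt := esym (linspace_closed_cell A x).
apply/(balanced_atE XW Xt Ct dt tx xt); rewrite linspace_closed_cell.
apply: eq_balanced_germ (bal x _); last first.
  by rewrite -dt /pdim linspace_closed_cell.
move=> v vx; rewrite /germ; have := dim_flat_push vx.
rewrite -linspace_closed_cell -/(pdim _) dt leq_eqVlt => /predU1P[e|dlt].
  by rewrite weight_at_arr.
(* Here the push lands in a cell of dimension above [d], where both functions vanish. *)
transitivity (0 : int).
  by apply/eqP; apply: contraTT dlt => /wd; rewrite leqNgt.
apply/esym/eqP; apply: contraTT dlt => /weight_at_neq0[s [[Cs _] sv _]].
by rewrite -leqNgt; exact: (dim_flat_le XW Xt Cs sv).
Qed.

Lemma push_shrink A x v (e : R) : 0 < e -> e <= push_size A x v ->
  same_cell A (x + e *: v) (push A x v).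
Proof.
move=> e0 ele h hA; rewrite sgn_push //; move: ele; rewrite /push_size.
by case: cid => r [r0 r1 rP] /= er; apply: rP; rewrite // e0.
Qed.

(** An inequality of [t] that is tight at [x] cuts out a face through [x]. This face has the span of
    [t], so the normal vanishes on that span, and a small push violates no inequality. *)
Lemma interior_push A t x v : polyhedron t -> tame A t -> t x ->
  (forall F, face F t -> F x -> linspace F = linspace t) ->
  v \in linspace t -> t (push A x v).
Proof.
move=> /polyhedron_halfspaces[K Kint tE] [_ sat] tx int vt.
have tight h : h \in K -> sgn h x = 0 -> dot h.1 v = 0.
  move=> hK hx; pose F := [set y | t y /\
    forall u, t u -> (h.1 *m u) 0 0 <= (h.1 *m y) 0 0].
  have Fx : F x.
    split=> // u; rewrite tE => /(_ h hK); rewrite sgr_le0 subr_le0 => /le_trans; apply.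
    by move/eqP: hx; rewrite sgr_eq0 subr_eq0 => /eqP <-.
  have FE := int F (conj (ex_intro _ x Fx) (ex_intro _ h.1 erefl)) Fx.
  have: v \in lker (linfun (mulmx h.1 : V -> 'cV_1)).
    rewrite -FE in vt; apply: subvP (proj2 (linspaceP F) _ _) _ vt.
    move=> y y' [ty ymax] [ty' y'max]; rewrite memv_ker lfunE /=.
    apply/eqP/matrixP => i j; rewrite !ord1 [RHS]mxE; apply/eqP.
    rewrite -/(dot h.1 (y - y')) dotB subr_eq0 eq_le.
    by apply/andP; split; [exact: y'max|exact: ymax].
  by rewrite memv_ker lfunE /= /dot => /eqP ->; rewrite mxE.
(* The step must be short both for the inequalities [K] of [t] and for [A]; saturation then carries
   the result to the push for [A]. *)
pose e := Num.min (push_size A x v) (push_size K x v).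
have e0 : 0 < e by rewrite lt_min !push_size_gt0.
have te : t (x + e *: v).
  have eK : e <= push_size K x v by rewrite ge_min lexx orbT.
  rewrite tE => h hK; rewrite (push_shrink e0 eK) // sgn_push //.
  case: eqP => [hx|_]; first by rewrite tight ?sgr0.
  by move: tx; rewrite tE; apply.
have eA : e <= push_size A x v by rewrite ge_min lexx.
exact: same_cell_saturated sat (push_shrink e0 eA) te.
Qed.

(** Since [A] may be finer than [X], a point with a flat of dimension [d - 1] need not lie on a
    ridge. Let [t] be a cell of least dimension through it. Either [t] is a ridge and balancing of
    [X] applies, or [t] is a facet with the point in its relative interior and the germ is that of a
    linear space. With no such cell the germ is zero. *)
Lemma tropical_balanced A d X : integral A -> is_tropical_complex d X ->
  tame_complex A X -> balanced_function A d (weight_at d X).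
Proof.
move=> Aint [XW bal] Xt x xd; set w := weight_at d X.
have w_facet v : germ A w x v != 0 ->
    exists s, [/\ facet d X s, s (push A x v), s x & weight X s != 0].
  move=> /weight_at_neq0[s [fs sv ws]]; exists s; split=> //.
  case: (Xt _ (proj1 fs)) => _ sat; exact: sat sv (@closed_cell_push _ _ A x v).
have [[t0 Ct0 t0x]|no] := pselect (exists2 t, cells X t & t x); last first.
  apply: balanced_germ0 => v vx; apply/eqP/negPn/negP => /w_facet[s [[Cs _] _ sx _]].
  by apply: no; exists s.
have ex : exists k, `[< exists2 t, cells X t /\ t x & pdim t = k >].
  by exists (pdim t0); apply/asboolP; exists t0.
case: (ex_minnP ex) => k /asboolP[t [Ct tx] tk] kmin.
have xt : (flat A x <= linspace t)%VS by exact: flat_sub_linspace (proj2 (Xt _ Ct)) tx.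
have [C1 C2 C3 C4] := proj1 XW.
have td : (pdim t <= d)%N.
  by have [r [_ <-] tr] := proj2 XW _ Ct; exact/dimvS/linspaceS.
have dle : (\dim (flat A x) <= pdim t)%N by exact: dimvS.
have := dle; rewrite leq_eqVlt => /predU1P[e|dlt].
  have xtE : flat A x = linspace t by apply/eqP; rewrite eqEdim xt -/(pdim t) e /=.
  have dt : (pdim t).+1 = d by rewrite -e.
  rewrite xtE; apply/(balanced_atE XW Xt Ct dt tx xtE); exact: bal.
have dt : pdim t = d by apply/eqP; rewrite eqn_leq td -xd.
have ft : facet d X t by [].
have int F : face F t -> F x -> linspace F = linspace t.
  move=> Ft Fx; apply/eqP; rewrite eqEdim linspaceS /=; last exact: face_sub.
  rewrite -/(pdim t) tk; apply: kmin; apply/asboolP; exists F => //.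
  by split=> //; exact: C3 Ft.
have facet_x s : facet d X s -> s x -> s = t.
  move=> fs sx; have [|Fs Ft] := C4 s t (proj1 fs) Ct; first by exists x.
  have [z [sz tz] e] := exists_relint (Xt _ (C3 _ _ Ct Ft)) (face_nonempty Ft).
  apply: (facet_unique XW Xt fs ft sz tz).
  by rewrite e int // -/(pdim t).
apply: (@balanced_germ_linear A x (linspace t) _ (weight X t)) => //.
- by rewrite -/(pdim t) dt.
- move=> v vt vx; have tv : t (push A x v).
    by apply: interior_push => //; [exact: (C2 _ Ct).1|exact: Xt].
  apply: (weight_at_facet XW Xt ft tv); apply/eqP.
  by rewrite eqn_leq (dim_flat_le XW Xt Ct tv) -xd dim_flat_push.
move=> v vt; apply/eqP/negPn/negP => /w_facet[s [fs sv sx _]].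
have e := facet_x _ fs sx; subst s; move: vt; have := linspace_diff sv tx.
by rewrite push_sub rpredZeq gt_eqF ?push_size_gt0 //= => ->.
Qed.

(* The germ at [q] of [w], multiplied by [c] and extended conically from [q]. *)
Definition star A (c : int) q w x : int := c * w (tits A q x).

Lemma star_constructible A c q w : constructible A w -> constructible A (star A c q w).
Proof.
by move=> wc x y xy; congr (_ * _); apply: wc => h hA; rewrite !sgn_tits // xy.
Qed.

Lemma star_small_support A d c q w :
  small_support A d w -> small_support A d (star A c q w).
Proof.
move=> wd x; rewrite mulf_eq0 negb_or => /andP[_ /wd]; apply: leq_trans.
exact/dimvS/flat_sub_tits.
Qed.

(** The flat at [x'] may be larger than that at [x]. If its dimension is still [d - 1], balancing of
    [w] at [x'] applies; if it is [d], the germ is that of a linear space; above [d] the germ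
    vanishes. *)
Lemma star_balanced A d c q w : integral A -> constructible A w ->
  small_support A d w -> balanced_function A d w ->
  balanced_function A d (star A c q w).
Proof.
move=> Aint wc wd bal x xd; pose x' := tits A q x.
have germE v : germ A (star A c q w) x v = c * germ A w x' v.
  congr (_ * _); apply: wc => h hA; rewrite sgn_tits //.
  rewrite [in LHS]sgn_push // [RHS]sgn_push // /x' !sgn_tits //.
  by case: (eqVneq (sgn h q) 0) => // /negPf ->.
suff: balanced_germ (flat A x) (fun v => c * germ A w x' v).
  by apply: eq_balanced_germ => v _; rewrite germE.
apply: balanced_germ_scale.
have le := flat_sub_tits A q x; have := dimvS le; rewrite -/x'.
rewrite leq_eqVlt => /predU1P[e|].
  have -> : flat A x = flat A x' by apply/eqP; rewrite eqEdim le e /=.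
  by apply: bal; rewrite -e.
rewrite xd => dle.
have germ0 v : v \notin flat A x' -> germ A w x' v = 0.
  move=> /dim_flat_push dlt; apply/eqP/negPn/negP => /wd.
  by rewrite leqNgt (leq_ltn_trans dle dlt).
have germ1 v : v \in flat A x' -> germ A w x' v = w x'.
  by move=> /push_flat; exact: wc.
move: dle; rewrite leq_eqVlt => /predU1P[e|dlt].
  by apply: (@balanced_germ_linear A x (flat A x') _ (w x')) => //;
    rewrite ?xd // => v /germ1.
apply: balanced_germ0 => v _; have [/germ1 ->|/germ0//] := boolP (v \in flat A x').
by apply/eqP/negPn/negP => /wd; rewrite leqNgt dlt.
Qed.

Lemma weight_at_small_support A d X : is_weighted_complex d X -> tame_complex A X ->
  small_support A d (weight_at d X).
Proof.
by move=> XW Xt x /weight_at_neq0[s [[Cs _] sx _]]; exact: (dim_flat_le XW Xt Cs sx).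
Qed.

End BalancedFunctions.

(** * Translations, sums and fan cycles *)

Section Translation.
Local Open Scope classical_set_scope.
Local Open Scope ring_scope.
Context {R : realType} {n : nat}.
Local Notation V := 'cV[R]_n.
Implicit Types (d : nat) (X Y Z : wcomplex R n).
Implicit Types (x y z p q u v : V) (s t P Q F : set V).

Lemma translateP p s x : translate p s x <-> s (x - p).
Proof.
split=> [[y sy <-]|sx]; first by rewrite addrK.
by exists (x - p); rewrite // subrK.
Qed.

Lemma translateE p s : translate p s = [set x | s (x - p)].
Proof. by apply/seteqP; split=> x /translateP. Qed.

Lemma translateNK p s : translate p (translate (- p) s) = s.
Proof. by rewrite !translateE /=; apply/seteqP; split=> x /=; rewrite opprK subrK. Qed.

Lemma translateK p s : translate (- p) (translate p s) = s.
Proof. by rewrite -{2}[p]opprK translateNK. Qed.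

Lemma translate_inj p : injective (translate p).
Proof. exact: can_inj (translateK p). Qed.

Lemma translate_nonempty p s : s !=set0 -> translate p s !=set0.
Proof. by move=> [x sx]; exists (x + p); exists x. Qed.

Lemma translateS p s t : s `<=` t -> translate p s `<=` translate p t.
Proof. exact: image_subset. Qed.

Lemma translateI p s t : translate p (s `&` t) = translate p s `&` translate p t.
Proof. by rewrite !translateE; apply/seteqP; split. Qed.

Lemma translate_bigcup p (C : set (set V)) :
  translate p (\bigcup_(s in C) s) = \bigcup_(s in [set translate p s | s in C]) s.
Proof.
apply/seteqP; split=> x.
  by move=> /translateP[s Cs sx]; exists (translate p s); [exists s|exact/translateP].
by move=> [_ [s Cs <-]] /translateP sx; apply/translateP; exists s.
Qed.

Lemma linspace_translate p s : linspace (translate p s) = linspace s.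
Proof.
apply: linspaceE => [x y /translateP sx /translateP sy|].
  by have := linspace_diff sx sy; rewrite opprB addrA subrK.
apply: (proj2 (linspaceP s)) => x y sx sy.
have := @linspace_diff _ _ (translate p s) (x + p) (y + p).
by rewrite opprD addrACA subrr addr0; apply; [exists x|exists y].
Qed.

Lemma pdim_translate p s : pdim (translate p s) = pdim s.
Proof. by rewrite /pdim linspace_translate. Qed.

Lemma polyhedron_translate p s : polyhedron s -> polyhedron (translate p s).
Proof.
move=> [m [A [b [Aint ->]]]]; exists m, A, (b + A *m p); split=> //.
rewrite translateE; apply/seteqP; split=> x /= xs i; have := xs i.
  by rewrite mulmxBr !mxE lerBlDr.
by rewrite mulmxBr !mxE lerBlDr.
Qed.

Lemma face_translate p F P : face F P -> face (translate p F) (translate p P).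
Proof.
move=> [F0 [a FE]]; split; first exact: translate_nonempty.
exists a; rewrite !translateE FE; apply/seteqP; split=> x /= [Px xmax]; split=> // y Py.
  have := xmax _ Py; rewrite -/(dot a (y - p)) -/(dot a (x - p)) !dotB.
  by rewrite lerD2r.
have := xmax (y + p); rewrite addrK => /(_ Py).
rewrite -/(dot a (y + p)) -/(dot a x) dotD -lerBrDr -dotB; exact: id.
Qed.

Lemma face_translateE p F P : face F (translate p P) <-> face (translate (- p) F) P.
Proof.
split=> [/(face_translate (- p))|/(face_translate p)]; first by rewrite translateK.
by rewrite translateNK.
Qed.

Lemma primitive_generator_translate p s t :
  primitive_generator (translate p s) (translate p t) = primitive_generator s t.
Proof.
rewrite /primitive_generator; congr (xget 0 _); apply/seteqP.
split=> v [vint vt [c [x [y [c0 sx ty vc]]]] vk]; split=> //;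
  rewrite ?linspace_translate // in vt vc vk *.
  exists c, (x - p), (y - p); split; [by []|exact/translateP|exact/translateP|].
  by rewrite opprB addrA subrK.
exists c, (x + p), (y + p); split; [by []|by exists x|by exists y|].
by rewrite opprD addrACA subrr addr0.
Qed.

Lemma cells_translate p X s :
  cells (translate_complex p X) s <-> cells X (translate (- p) s).
Proof.
split=> [[t Xt <-]|Xs]; first by rewrite translateK.
by exists (translate (- p) s); rewrite // translateNK.
Qed.

Lemma facet_translate p d X s :
  facet d (translate_complex p X) s <-> facet d X (translate (- p) s).
Proof. by rewrite /facet cells_translate pdim_translate. Qed.

Lemma translate_complexK p X : translate_complex (- p) (translate_complex p X) = X.
Proof.
case: X => C w; rewrite /translate_complex /=; congr WComplex.
  apply/seteqP; split=> s.
    by move=> [_ [t Ct <-] <-]; rewrite translateK.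
  by move=> Cs; exists (translate p s); [exists s|rewrite translateK].
by apply/funext => s; rewrite opprK translateK.
Qed.

Lemma weighted_translate p d X :
  is_weighted_complex d X -> is_weighted_complex d (translate_complex p X).
Proof.
move=> [[C1 C2 C3 C4] pur]; split.
  split=> [|s /cells_translate/C2[sP s0]|s t /cells_translate Xs ts|
           s t /cells_translate Xs /cells_translate Xt st0].
  - exact: finite_image.
  - by rewrite -[s](translateNK p); split;
      [exact: polyhedron_translate|exact: translate_nonempty].
  - by apply/cells_translate; apply: C3 Xs _; exact: face_translate.
  have [|Fs Ft] := C4 _ _ Xs Xt.
    by rewrite -translateI; exact: translate_nonempty.
  rewrite -translateI in Fs Ft.
  have := face_translate p Fs; have := face_translate p Ft.
  by rewrite !translateNK.
move=> s /cells_translate/pur[t ft st]; exists (translate p t).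
  by apply/facet_translate; rewrite translateK.
by rewrite -[s](translateNK p); exact: translateS.
Qed.

Lemma tropical_translate p d X :
  is_tropical_complex d X -> is_tropical_complex d (translate_complex p X).
Proof.
move=> [XW bal]; split=> [|t /cells_translate Xt td]; first exact: weighted_translate.
have td' : (pdim (translate (- p) t)).+1 = d by rewrite pdim_translate.
have := bal _ Xt td'; rewrite /balanced_at linspace_translate.
suff -> : \sum_(s \in [set s | facet d X s /\ face (translate (- p) t) s])
    (weight X s)%:~R *: primitive_generator s (translate (- p) t) =
  \sum_(s \in [set s | facet d (translate_complex p X) s /\ face t s])
    (weight (translate_complex p X) s)%:~R *: primitive_generator s t by [].
rewrite [RHS](@reindex_fsbig _ _ _ _ _ (translate p)
  [set s | facet d X s /\ face (translate (- p) t) s]); last first.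
  split=> [s [fs ts]|s s' _ _ /translate_inj//|s [/facet_translate fs ts]] /=.
    split; first by apply/facet_translate; rewrite translateK.
    by apply/face_translateE.
  exists (translate (- p) s); last exact: translateNK.
  by split=> //; exact: face_translate.
apply: eq_fsbigr => s _; rewrite /= translateK -{2}[t](translateNK p).
by rewrite primitive_generator_translate.
Qed.

Lemma discard_zero_translate p d X :
  discard_zero d (translate_complex p X) = translate_complex p (discard_zero d X).
Proof.
congr WComplex; apply/seteqP; split=> t.
  move=> [s [/facet_translate fs ws ts]]; apply/cells_translate.
  by exists (translate (- p) s); split=> //; exact: face_translate.
move=> /cells_translate[s [fs ws ts]]; exists (translate p s); split.
- by apply/facet_translate; rewrite translateK.
- by rewrite /= translateK.
by apply/face_translateE.
Qed.

Lemma refines_translate p d Z X : refines d Z X ->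
  refines d (translate_complex p Z) (translate_complex p X).
Proof.
move=> [ZU Zsub Zw]; split.
- by rewrite -!translate_bigcup ZU.
- move=> s /cells_translate/Zsub[t Xt st]; exists (translate p t); first by exists t.
  by rewrite -[s](translateNK p); exact: translateS.
move=> s t /facet_translate fs /facet_translate ft st.
by apply: Zw => //; exact: translateS.
Qed.

Lemma equivalent_translate p d X Y : equivalent d X Y ->
  equivalent d (translate_complex p X) (translate_complex p Y).
Proof.
move=> [Z [ZW ZX ZY]]; exists (translate_complex p Z).
by rewrite !discard_zero_translate; split;
  [exact: weighted_translate|exact: refines_translate|exact: refines_translate].
Qed.

Lemma translate_cycle_class p d X :
  translate_cycle p (cycle_class d X) = cycle_class d (translate_complex p X).
Proof.
apply/seteqP; split=> Z.
  move=> [Y [YT XY] <-]; split; first exact: tropical_translate.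
  exact: equivalent_translate.
move=> [ZT XZ]; exists (translate_complex (- p) Z).
  split; first exact: tropical_translate.
  by have := equivalent_translate (- p) XZ; rewrite translate_complexK.
by rewrite -{1}[p]opprK translate_complexK.
Qed.

Lemma support_translate p d X :
  Defs.support d (translate_complex p X) = translate p (Defs.support d X).
Proof.
apply/seteqP; split=> x.
  move=> [s [/facet_translate fs ws] sx]; apply/translateP.
  exists (translate (- p) s); first by split.
  by apply/translateP; rewrite opprK subrK.
move=> /translateP[s [fs ws] sx]; exists (translate p s); last exact/translateP.
by split; [apply/facet_translate; rewrite translateK|rewrite /= translateK].
Qed.

End Translation.

(** * Sums of cycles *)

Section Sums.
Local Open Scope classical_set_scope.
Local Open Scope ring_scope.
Context {R : realType} {n : nat}.
Local Notation V := 'cV[R]_n.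
Implicit Types (A : seq ('rV[R]_n * R)) (d : nat) (X Y Z : wcomplex R n).
Implicit Types (x y z p q u v : V) (s t P Q F : set V) (w : V -> int).

Lemma equivalent_refl d X : is_weighted_complex d X -> equivalent d X X.
Proof.
move=> XW; have [A Aint AP] := exists_tame (proj1 XW).
have Xt : tame_complex A X by exact: AP.
exact: (weight_at_equivalent Aint).
Qed.

Lemma support_discard_zero d X : is_weighted_complex d X ->
  \bigcup_(s in cells (discard_zero d X)) s = Defs.support d X.
Proof.
move=> XW; apply/seteqP; split=> x.
  by move=> [t [s [fs ws /face_sub ts]] /ts sx]; exists s.
move=> [s [fs ws] sx]; exists s => //; exists s; split=> //.
by apply: face_refl; exists x.
Qed.

Lemma cycle_support_class d X :
  is_tropical_complex d X -> cycle_support d (cycle_class d X) = Defs.support d X.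
Proof.
move=> XT; have XW := proj1 XT; apply/seteqP; split=> x.
  move=> [Y [[YW _] [Z [_ [ZX _ _] [ZY _ _]]]]].
  by rewrite -!support_discard_zero // -ZX -ZY.
by move=> Xx; exists X => //; split=> //; exact: equivalent_refl.
Qed.

Lemma facet_union d X Y s : facet d (union_complex X Y) s <->
  facet d X s \/ facet d Y s.
Proof.
split=> [[[Xs|Ys] sd]|[[Xs sd]|[Ys sd]]].
- by left.
- by right.
- by split=> //; left.
by split=> //; right.
Qed.

Lemma union_weighted d X Y : is_weighted_complex d X -> is_weighted_complex d Y ->
  is_polyhedral_complex (cells X `|` cells Y) ->
  is_weighted_complex d (union_complex X Y).
Proof.
move=> [_ purX] [_ purY] XY; split=> // s [/purX|/purY] [t ft st];
  exists t => //; apply/facet_union; by [left|right].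
Qed.

Lemma union_tame A X Y : tame_complex A X -> tame_complex A Y ->
  tame_complex A (union_complex X Y).
Proof. by move=> Xt Yt s [/Xt|/Yt]. Qed.

(** Because the union is again a complex, it has at most one facet through [z], and any facet of [X]
    or [Y] through [z] must be that one. *)
Lemma weight_at_union A d X Y z :
  is_weighted_complex d X -> tame_complex A X ->
  is_weighted_complex d Y -> tame_complex A Y ->
  is_polyhedral_complex (cells X `|` cells Y) -> \dim (flat A z) = d ->
  weight_at d (union_complex X Y) z = weight_at d X z + weight_at d Y z.
Proof.
move=> XW Xt YW Yt XY zd.
have UW := union_weighted XW YW XY; have Ut := union_tame Xt Yt.
have [[s fs sz]|no] := pselect (exists2 s, facet d (union_complex X Y) s & s z).
  have weightE W : is_weighted_complex d W -> tame_complex A W ->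
      (forall r, facet d W r -> facet d (union_complex X Y) r) ->
      (if `[< cells W s >] then weight W s else 0) = weight_at d W z.
    move=> WW Wt sub; case: asboolP => Ws.
      have fWs : facet d W s by split=> //; case: fs.
      by rewrite (weight_at_facet WW Wt fWs sz zd).
    apply/esym/eqP/negPn/negP => /weight_at_neq0[r [fr rz _]].
    by apply: Ws; rewrite -(facet_unique UW Ut (sub _ fr) fs rz sz zd); case: fr.
  rewrite (weight_at_facet UW Ut fs sz zd) /= !weightE //.
    by move=> r fr; apply/facet_union; right.
  by move=> r fr; apply/facet_union; left.
have zero W : (forall r, facet d W r -> facet d (union_complex X Y) r) ->
    weight_at d W z = 0.
  move=> sub; apply/eqP/negPn/negP => /weight_at_neq0[r [fr rz _]].
  by apply: no; exists r => //; exact: sub.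
rewrite !zero ?addr0 // => r fr; apply/facet_union; [by right|by left].
Qed.

Lemma equivalent_union d X Y X' Y' :
  is_weighted_complex d X -> is_weighted_complex d Y ->
  is_weighted_complex d X' -> is_weighted_complex d Y' ->
  is_polyhedral_complex (cells X `|` cells Y) ->
  is_polyhedral_complex (cells X' `|` cells Y') ->
  equivalent d X X' -> equivalent d Y Y' ->
  equivalent d (union_complex X Y) (union_complex X' Y').
Proof.
move=> XW YW XW' YW' XY XY' /(equivalent_weight_at XW XW')[A Aint AP].
move=> /(equivalent_weight_at YW YW')[B Bint BP].
have ABint : integral (A ++ B) by move=> h; rewrite mem_cat => /orP[/Aint|/Bint].
have [|Xt Xt' XX'] := AP (A ++ B); first by move=> h hA; rewrite mem_cat hA.
have [|Yt Yt' YY'] := BP (A ++ B); first by move=> h hB; rewrite mem_cat hB orbT.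
apply: (weight_at_equivalent ABint); try exact: union_weighted; try exact: union_tame.
move=> z zd; rewrite (weight_at_union XW Xt YW Yt) //.
by rewrite (weight_at_union XW' Xt' YW' Yt') // XX' ?YY'.
Qed.

(** The sum does not depend on the representatives, because weight functions of unions add at points
    whose flat has dimension [d]. *)
Lemma cycle_add_class d X Y : is_tropical_complex d X -> is_tropical_complex d Y ->
  is_polyhedral_complex (cells X `|` cells Y) ->
  cycle_add d (cycle_class d X) (cycle_class d Y) = cycle_class d (union_complex X Y).
Proof.
move=> XT YT XY; have XW := proj1 XT; have YW := proj1 YT.
apply/seteqP; split=> Z.
  move=> [X' [Y' [[[XW' _] XX'] [[YW' _] YY'] XY' ZXY']]].
  rewrite (@cycle_class_equivalent _ _ _ _ (union_complex X' Y')) //.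
  - exact: union_weighted.
  - exact: union_weighted.
  exact: equivalent_union.
move=> ZXY; exists X, Y; split=> //; split=> //; exact: equivalent_refl.
Qed.

Lemma union_arr A d w1 w2 : union_complex (arr_complex A d w1) (arr_complex A d w2) =
  arr_complex A d (fun x => w1 x + w2 x).
Proof.
congr WComplex; first exact: setUid.
by apply/funext => s /=; case: asboolP.
Qed.

(** Both complexes have the same cells, hence the same facets at each ridge, and the two balancing
    sums add. *)
Lemma arr_add_tropical A d w1 w2 : is_tropical_complex d (arr_complex A d w1) ->
  is_tropical_complex d (arr_complex A d w2) ->
  is_tropical_complex d (arr_complex A d (fun x => w1 x + w2 x)).
Proof.
move=> [XW bal1] [_ bal2]; split=> // t Ct td.
have fin : finite_set [set s | facet d (arr_complex A d w1) s /\ face t s].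
  by apply: sub_finite_set (let: And4 f _ _ _ := proj1 XW in f) => s [[]].
have E s : (weight (arr_complex A d (fun x => w1 x + w2 x)) s)%:~R =
    (weight (arr_complex A d w1) s)%:~R + (weight (arr_complex A d w2) s)%:~R :> R.
  by rewrite -intrD /=; case: asboolP.
rewrite /balanced_at; under eq_fsbigr do rewrite E scalerDl.
rewrite (@fsbig_split _ _ _ _ [set s | facet d (arr_complex A d w1) s /\ face t s]) //.
exact: rpredD (bal1 t Ct td) (bal2 t Ct td).
Qed.

Lemma cycle_add_arr A d w1 w2 : is_tropical_complex d (arr_complex A d w1) ->
  is_tropical_complex d (arr_complex A d w2) ->
  cycle_add d (cycle_class d (arr_complex A d w1)) (cycle_class d (arr_complex A d w2)) =
  cycle_class d (arr_complex A d (fun x => w1 x + w2 x)).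
Proof.
move=> T1 T2; rewrite cycle_add_class ?union_arr //.
by rewrite [_ `|` _]setUid; case: T1 => -[].
Qed.

(** This starts the iterated sum inside the complexes carried by [A]. *)
Lemma cycle_zero_arr A d : integral A ->
  cycle_zero d = cycle_class d (arr_complex A d (fun=> 0)) :> set (wcomplex R n).
Proof.
move=> Aint; have W0 : is_weighted_complex d (@WComplex R n set0 (fun=> 0)).
  by split=> //; split=> // s t [].
have t0 : tame_complex A (@WComplex R n set0 (fun=> 0)) by move=> s [].
apply: cycle_class_equivalent => //; first exact: arr_weighted.
apply: (weight_at_equivalent Aint) => //; [exact: arr_weighted|exact: arr_tame|].
move=> z zd; rewrite weight_at_arr //.
by apply/eqP/negPn/negP => /weight_at_neq0[s [[]]].
Qed.

Lemma sum_cycle_class (I : eqType) A d (r : seq I) (W : I -> V -> int) : integral A ->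
  (forall i, is_tropical_complex d (arr_complex A d (W i))) ->
  is_tropical_complex d (arr_complex A d (fun x => \sum_(i <- r) W i x)) /\
  \big[cycle_add d/cycle_zero d]_(i <- r) cycle_class d (arr_complex A d (W i)) =
    cycle_class d (arr_complex A d (fun x => \sum_(i <- r) W i x)).
Proof.
move=> Aint WT; elim: r => [|i r [IHT IH]].
  have -> : (fun x => \sum_(i <- [::]) W i x) = fun=> 0.
    by apply/funext => x; rewrite big_nil.
  rewrite big_nil (cycle_zero_arr d Aint); split=> //.
  apply: arr_tropical => // x xd; apply: balanced_germ0 => //.
have -> : (fun x => \sum_(j <- i :: r) W j x) = fun x => W i x + \sum_(j <- r) W j x.
  by apply/funext => x; rewrite big_cons.
split; first exact: arr_add_tropical.
by rewrite big_cons IH cycle_add_arr.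
Qed.

End Sums.

(** * Stars as translated fan cycles *)

Section FanCycles.
Local Open Scope classical_set_scope.
Local Open Scope ring_scope.
Context {R : realType} {n : nat}.
Local Notation V := 'cV[R]_n.
Implicit Types (A : seq ('rV[R]_n * R)) (d : nat) (X Y Z : wcomplex R n).
Implicit Types (x y z p q u v : V) (s t P Q F : set V) (w : V -> int).

(** All these hyperplanes contain [q], so the closed cells of this subarrangement become cones with
    vertex 0 when [q] is moved to the origin. *)
Definition through A q := [seq h <- A | sgn h q == 0].

Lemma cone_halfspaces K : integral K -> (forall h, h \in K -> h.2 = 0) ->
  cone ([set x | forall h, h \in K -> sgn h x <= 0] : set V).
Proof.
move=> /halfspaces_matrix[m [A [b [Aint b0 ->]]]] K0; exists m, A; split=> //.
have bi i : b i 0 = 0 by rewrite (b0 K0) mxE.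
by apply/seteqP; split=> x /= xA i; have := xA i; rewrite bi.
Qed.

Lemma cone_through A q z : integral A ->
  cone (translate (- q) (closed_cell (through A q) z)).
Proof.
move=> Aint; pose K := cell_halfspaces (through A q) z.
have Kq h : h \in K -> h.1 \is a mxOver Num.int /\ h.2 = dot h.1 q.
  have main g : g \in through A q -> g.1 \is a mxOver Num.int /\ g.2 = dot g.1 q.
    rewrite mem_filter sgr_eq0 subr_eq0 => /andP[/eqP <- /Aint].
    by split.
  rewrite mem_cat => /orP[|/mapP[g]]; rewrite mem_filter => /andP[_ /main[gi gq]] //.
  move=> ->; split=> /=; last by rewrite gq /dot mulNmx [RHS]mxE.
  by apply/mxOverP => i j; rewrite mxE rpredN; exact: (mxOverP gi).
have -> : translate (- q) (closed_cell (through A q) z) =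
    [set x | forall h, h \in [seq (h.1, 0) | h <- K] -> sgn h x <= 0].
  rewrite closed_cellE translateE; apply/seteqP; split=> x /= xK.
    move=> _ /mapP[h hK ->]; have := xK h hK; have [_ hq] := Kq h hK.
    by rewrite /sgn opprK dotD hq addrK /= subr0.
  move=> h hK; have [_ hq] := Kq h hK.
  have := xK (h.1, 0); rewrite /sgn opprK dotD hq addrK /= subr0; apply.
  by apply/mapP; exists h.
apply: cone_halfspaces => h /mapP[g gK ->] //=.
by case: (Kq g gK).
Qed.

(* For [y] in the cone of [z] at [q], the cell of [tits A y z] contains [y] and
   has the same germ at [q] as that of [z]. *)
Lemma support_star A d c q w : integral A -> constructible A w ->
  small_support A d w ->
  Defs.support d (arr_complex A d (star A c q w)) =
  \bigcup_(z in [set z | \dim (flat A z) = d /\ star A c q w z != 0])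
     closed_cell (through A q) z.
Proof.
move=> Aint wc wd; have sc := star_constructible c q wc.
apply/seteqP; split=> y.
  move=> [s [/arr_facetP[z -> zd]]]; rewrite arr_weight // => wz zy; exists z => //.
  by move=> h; rewrite mem_filter => /andP[_ /zy].
move=> [z [zd wz] zy].
have wzE : star A c q w (tits A y z) = star A c q w z.
  congr (_ * _); apply: wc => h hA; rewrite !sgn_tits //.
  case: (eqVneq (sgn h q) 0) => // hq; case: (eqVneq (sgn h y) 0) => // hy.
  have [|e|//] := zy h; first by rewrite mem_filter hq eqxx.
  by rewrite e eqxx in hy.
have dE : \dim (flat A (tits A y z)) = d.
  apply/eqP; rewrite eqn_leq; apply/andP; split.
    by apply: (star_small_support (c := c) (q := q) wd); rewrite wzE.
  by rewrite -[X in (X <= _)%N]zd dimvS // flat_sub_tits.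
exists (closed_cell A (tits A y z)); last exact: closed_cell_push.
by split; [exact/arr_facet|rewrite arr_weight // wzE].
Qed.

Lemma fan_star A d c q w : integral A -> constructible A w ->
  small_support A d w -> balanced_function A d w ->
  is_fan_cycle d
    (translate_cycle (- q) (cycle_class d (arr_complex A d (star A c q w)))).
Proof.
move=> Aint wc wd wb; set X := arr_complex A d _.
have XT : is_tropical_complex d X.
  apply: arr_tropical => //; [exact: star_constructible|exact: star_small_support|].
  exact: star_balanced.
rewrite translate_cycle_class; have TT := tropical_translate (- q) XT.
split; first by exists (translate_complex (- q) X).
pose S := [set z | \dim (flat A z) = d /\ star A c q w z != 0].
exists [set translate (- q) (closed_cell (through A q) z) | z in S]; split.
- apply: (@sub_finite_set _ _ (translate (- q) @` range (closed_cell (through A q)))).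
    by move=> _ [z _ <-]; exists (closed_cell (through A q) z).
  exact/finite_image/finite_closed_cells.
- by move=> _ [z _ <-]; exact: cone_through.
rewrite cycle_support_class // support_translate support_star //.
apply/seteqP; split=> x.
  by move=> /translateP[z Sz zx]; exists (translate (- q) (closed_cell (through A q) z));
    [exists z|exact/translateP].
by move=> [_ [z Sz <-]] /translateP zx; apply/translateP; exists z.
Qed.

End FanCycles.

Theorem theorem5p4 (R : realType) (n d : nat) (X : set (wcomplex R n))
    (hX : is_tropical_cycle d X) :
  exists (l : nat) (F : 'I_l -> set (wcomplex R n)) (p : 'I_l -> 'cV[R]_n),
    (forall i, is_fan_cycle d (F i)) /\
    X = \big[cycle_add d/cycle_zero d]_(i < l) translate_cycle (p i) (F i).
Proof.
case: hX => X0 X0T ->; have X0W := proj1 X0T.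
have [A Aint AP] := exists_tame (proj1 X0W); have X0t := AP A (fun _ hA => hA).
pose w := weight_at d X0.
have wc : constructible A w by move=> x y; exact: weight_at_same_cell.
have wd : small_support A d w by exact: weight_at_small_support.
have wb : balanced_function A d w by exact: tropical_balanced.
have [E EP] := euler_decomposition A.
pose e0 : int * 'cV[R]_n := (0, 0)%R.
pose W (e : int * 'cV[R]_n) := star A e.1 e.2 w.
pose C e := cycle_class d (arr_complex A d (W e)).
(* A star is a fan only after its centre is moved to the origin. The coefficient is already part of
   its weights, so no multiples of cycles occur. *)
exists (size E), (fun i => translate_cycle (- (nth e0 E i).2)%R (C (nth e0 E i))).
exists (fun i => (nth e0 E i).2); split=> [i|]; first exact: fan_star.
transitivity (\big[cycle_add d/cycle_zero d]_(i < size E) C (nth e0 E i)); last first.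
  apply: eq_bigr => i _; rewrite /C !translate_cycle_class.
  by rewrite -{1}[(nth e0 E i).2]GRing.opprK translate_complexK.
transitivity (\big[cycle_add d/cycle_zero d]_(e <- E) C e); last first.
  by rewrite (big_nth e0) big_mkord.
have WT e : is_tropical_complex d (arr_complex A d (W e)).
  apply: arr_tropical => //; [exact: star_constructible|exact: star_small_support|].
  exact: star_balanced.
rewrite (sum_cycle_class E Aint WT).2.
have -> : (fun x => \sum_(e <- E) W e x)%R = w by apply/funext => x; rewrite -EP.
apply: cycle_class_equivalent => //; first exact: arr_weighted.
apply: (weight_at_equivalent Aint) => //; [exact: arr_weighted|exact: arr_tame|].
by move=> z zd; rewrite weight_at_arr.
Qed.
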